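(* The split $\rightarrow$ unit interval problem can be solved in polynomial time: given a split graph $G$, a minimum set $V_-\subseteq V(G)$ such that $G - V_-$ is a unit interval graph can be computed in polynomial time.
   Context: All graphs are finite, simple and undirected. A graph is a split graph if its vertex set can be partitioned into a clique and an independent set. A graph is a unit interval graph if its vertices can be assigned intervals of the real line, all of the same length, so that two vertices are adjacent iff their intervals intersect. *)

(* Defs.v *)
From HB Require Import structures.
From mathcomp Require Import all_boot all_order all_algebra.
From mathcomp Require Import boolp classical_sets set_interval reals.
Set Implicit Arguments.
Unset Strict Implicit.
Unset Printing Implicit Defensive.

Record sgraph (T : finType) := SGraph {
  adj :> rel T;
  adj_sym : symmetric adj;
  adj_irrefl : irreflexive adj
}.

Section InducedSubgraph.
Variables (T : finType) (G : sgraph T) (A : {set T}).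

Definition induced_adj : rel {x : T | x \in A} := fun x y => G (val x) (val y).

Lemma induced_adj_sym : symmetric induced_adj.
Proof. by move=> x y; apply: adj_sym. Qed.

Lemma induced_adj_irrefl : irreflexive induced_adj.
Proof. by move=> x; apply: adj_irrefl. Qed.

Definition induced : sgraph {x : T | x \in A} :=
  SGraph induced_adj_sym induced_adj_irrefl.

End InducedSubgraph.

Definition del_vertices (T : finType) (G : sgraph T) (S : {set T}) :=
  induced G (~: S).

Definition clique (T : finType) (G : sgraph T) (K : {set T}) : Prop :=
  {in K &, forall x y, x != y -> G x y}.

Definition independent (T : finType) (G : sgraph T) (I : {set T}) : Prop :=
  {in I &, forall x y, ~~ G x y}.

Definition split_graph (T : finType) (G : sgraph T) : Prop :=
  exists K : {set T}, clique G K /\ independent G (~: K).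

(* [a x] is the left endpoint of the interval of [x], [l] the common length. *)
Definition unit_interval_graph (R : realType) (T : finType) (G : sgraph T)
    : Prop :=
  exists (l : R) (a : T -> R), (0 < l)%R /\
    forall x y : T, x != y ->
      (G x y <->
       (`[a x, (a x + l)%R] `&` `[a y, (a y + l)%R] !=set0)%classic).

Definition min_deletion_set (P : forall T : finType, sgraph T -> Prop)
    (T : finType) (G : sgraph T) (S : {set T}) : Prop :=
  P _ (del_vertices G S) /\
  forall S' : {set T}, P _ (del_vertices G S') -> #|S| <= #|S'|.

(* Polynomial time is measured on a random access machine with unit cost.     *)
(* Addition and truncated subtraction are the only arithmetic instructions,   *)
(* so that the bit length of the stored numbers grows by at most one per step *)
(* and t steps can be simulated by a Turing machine in time polynomial in t   *)
(* and the input length (with unit-cost multiplication this would fail).      *)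
Inductive instr :=
| IConst of nat & nat        (* IConst d c   : r_d := c              *)
| IMove of nat & nat         (* IMove d a    : r_d := r_a            *)
| IAdd of nat & nat & nat    (* IAdd d a b   : r_d := r_a + r_b      *)
| ISub of nat & nat & nat    (* ISub d a b   : r_d := r_a - r_b      *)
| ILoad of nat & nat         (* ILoad d a    : r_d := M[r_a]         *)
| IStore of nat & nat        (* IStore a b   : M[r_a] := r_b         *)
| IJump of nat               (* IJump k      : goto k                *)
| IJumpZ of nat & nat.       (* IJumpZ a k   : if r_a = 0 then goto k *)

Definition program := seq instr.

Record state := State { pc : nat; regs : nat -> nat; memory : nat -> nat }.

Definition upd (f : nat -> nat) (i x : nat) : nat -> nat :=
  fun j => if j == i then x else f j.

Definition exec (i : instr) (s : state) : state :=
  let: State k r m := s in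
  match i with
  | IConst d c => State k.+1 (upd r d c) m
  | IMove d a => State k.+1 (upd r d (r a)) m
  | IAdd d a b => State k.+1 (upd r d (r a + r b)) m
  | ISub d a b => State k.+1 (upd r d (r a - r b)) m
  | ILoad d a => State k.+1 (upd r d (m (r a))) m
  | IStore a b => State k.+1 r (upd m (r a) (r b))
  | IJump l => State l r m
  | IJumpZ a l => State (if r a == 0 then l else k.+1) r m
  end.

(* The machine halts when the program counter leaves the program. *)
Definition halted (p : program) (s : state) : bool := size p <= pc s.

Definition step (p : program) (s : state) : state :=
  if onth p (pc s) is Some i then exec i s else s.

Definition run (p : program) (t : nat) (s : state) : state := iter t (step p) s.

(* M[0] holds the number n of vertices; M[1 + u * n + v] is 1 if u and v are  *)
(* adjacent and 0 otherwise; every other cell and every register is 0.        *)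
Definition encode (n : nat) (G : sgraph 'I_n) : seq nat :=
  n :: [seq nat_of_bool (G u v) | u <- enum 'I_n, v <- enum 'I_n].

Definition init_state (n : nat) (G : sgraph 'I_n) : state :=
  State 0 (fun=> 0) (nth 0 (encode G)).

Definition output_set (n : nat) (s : state) : {set 'I_n} :=
  [set v : 'I_n | memory s v != 0].

(* On every graph satisfying the promise [P], one fixed program halts after a *)
(* number of steps polynomial in the number n of vertices (equivalently, in   *)
(* the length n ^ 2 + 1 of the input) and outputs a vertex set related to the *)
(* graph by [Q].                                                              *)
Definition solvable_in_polytime
    (P : forall n : nat, sgraph 'I_n -> Prop)
    (Q : forall n : nat, sgraph 'I_n -> {set 'I_n} -> Prop) : Prop :=
  exists (p : program) (q : {poly nat}),
    forall (n : nat) (G : sgraph 'I_n), P n G ->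
      exists t : nat, let s := run p t (init_state G) in
        [/\ t <= (q.[n])%R, halted p s & Q n G (output_set n s)].

(* Main.v *)
Require Import Defs.
From HB Require Import structures.
From mathcomp Require Import all_boot all_order all_algebra.
From mathcomp Require Import boolp classical_sets set_interval reals.
From mathcomp Require Import zify lra.
Set Implicit Arguments.
Unset Strict Implicit.
Unset Printing Implicit Defensive.

(* Let K be a clique with independent complement.  In a unit interval model   *)
(* of an induced subgraph, at most three vertices outside K have neighbours   *)
(* in K, and their neighbourhoods are very constrained.  Once these vertices  *)
(* are guessed, the forced deletions in K are known, and the other vertices   *)
(* outside K must become isolated: what remains is a minimum vertex cover in  *)
(* a bipartite graph.  Such a cover is read off the final prices of an        *)
(* auction, in which each unassigned row bids for its cheapest column.  The   *)
(* clique K itself can be taken to consist of the vertices of degree at least *)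
(* t, for some t.  All this is programmed with loops of exactly n rounds,     *)
(* so that the running time is a polynomial in n given by the program text.   *)

(** * A language of bounded loops *)

(* [ENum] is the number n of vertices, [EAddr a e] the address of the cell    *)
(* [e] of the array [a]: sixteen arrays are interleaved in the memory.        *)
Inductive expr :=
| EConst of nat
| ENum
| EVar of nat
| EAdd of expr & expr
| ESub of expr & expr
| EAddr of nat & expr
| ELoad of expr
| EIf of expr & expr & expr.

Inductive cmd :=
| CSet of nat & expr
| CStore of expr & expr
| CSeq of cmd & cmd
| CWhen of expr & cmd
| CLoop of nat & cmd.

Notation store := ((nat -> nat) * (nat -> nat))%type.

Definition setv (s : store) (x i : nat) : store := (upd s.1 x i, s.2).

Section Semantics.
Variable n : nat.

Fixpoint eval (s : store) (e : expr) : nat :=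
  match e with
  | EConst c => c
  | ENum => n
  | EVar x => s.1 x
  | EAdd e1 e2 => eval s e1 + eval s e2
  | ESub e1 e2 => eval s e1 - eval s e2
  | EAddr a e1 => 16 * eval s e1 + a
  | ELoad e1 => s.2 (eval s e1)
  | EIf e0 e1 e2 => if eval s e0 != 0 then eval s e1 else eval s e2
  end.

Fixpoint ev (c : cmd) (s : store) : store :=
  match c with
  | CSet x e => setv s x (eval s e)
  | CStore e1 e2 => (s.1, upd s.2 (eval s e1) (eval s e2))
  | CSeq c1 c2 => ev c2 (ev c1 s)
  | CWhen e c1 => if eval s e != 0 then ev c1 s else s
  | CLoop x c1 => iteri n (fun i s' => ev c1 (setv s' x i)) s
  end.

End Semantics.

(** * Compilation to the random access machine *)

(* Register 0 holds n, register 2x + 1 the variable x; the other even         *)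
(* registers are temporaries, those below [d] (or [h]) being in use.          *)
Fixpoint cexpr (d k : nat) (e : expr) : program :=
  match e with
  | EConst c => [:: IConst d.*2 c]
  | ENum => [:: IMove d.*2 0]
  | EVar x => [:: IMove d.*2 x.*2.+1]
  | EAdd e1 e2 =>
      let c1 := cexpr d k e1 in
      c1 ++ cexpr d.+1 (k + size c1) e2 ++ [:: IAdd d.*2 d.*2 d.+1.*2]
  | ESub e1 e2 =>
      let c1 := cexpr d k e1 in
      c1 ++ cexpr d.+1 (k + size c1) e2 ++ [:: ISub d.*2 d.*2 d.+1.*2]
  | EAddr a e1 =>
      cexpr d k e1 ++ nseq 4 (IAdd d.*2 d.*2 d.*2) ++
      [:: IConst d.+1.*2 a; IAdd d.*2 d.*2 d.+1.*2]
  | ELoad e1 => cexpr d k e1 ++ [:: ILoad d.*2 d.*2]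
  | EIf e0 e1 e2 =>
      let c0 := cexpr d k e0 in
      let k1 := (k + size c0).+1 in
      let c1 := cexpr d k1 e1 in
      let k2 := (k1 + size c1).+1 in
      let c2 := cexpr d k2 e2 in
      c0 ++ IJumpZ d.*2 k2 :: c1 ++ IJump (k2 + size c2) :: c2
  end.

Fixpoint ccmd (h k : nat) (c : cmd) : program :=
  match c with
  | CSet x e => cexpr h k e ++ [:: IMove x.*2.+1 h.*2]
  | CStore e1 e2 =>
      let c1 := cexpr h k e1 in
      c1 ++ cexpr h.+1 (k + size c1) e2 ++ [:: IStore h.*2 h.+1.*2]
  | CSeq c1 c2 =>
      let p1 := ccmd h k c1 in p1 ++ ccmd h (k + size p1) c2
  | CWhen e c1 =>
      let p0 := cexpr h k e in
      let k1 := (k + size p0).+1 in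
      let p1 := ccmd h k1 c1 in
      p0 ++ IJumpZ h.*2 (k1 + size p1) :: p1
  | CLoop x c1 =>
      let p1 := ccmd h.+1 (k + 4) c1 in
      [:: IConst h.*2 0; ISub h.+1.*2 0 h.*2;
          IJumpZ h.+1.*2 (k + 4 + size p1 + 3); IMove x.*2.+1 h.*2] ++
      p1 ++ [:: IConst h.+1.*2 1; IAdd h.*2 h.*2 h.+1.*2; IJump k.+1]
  end.

Fixpoint ecost (e : expr) : nat :=
  match e with
  | EConst _ | ENum | EVar _ => 1
  | EAdd e1 e2 | ESub e1 e2 => ecost e1 + ecost e2 + 1
  | EAddr _ e1 => ecost e1 + 6
  | ELoad e1 => ecost e1 + 1
  | EIf e0 e1 e2 => ecost e0 + ecost e1 + ecost e2 + 2
  end.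

Fixpoint cost (n : nat) (c : cmd) : nat :=
  match c with
  | CSet _ e => ecost e + 1
  | CStore e1 e2 => ecost e1 + ecost e2 + 1
  | CSeq c1 c2 => cost n c1 + cost n c2
  | CWhen e c1 => ecost e + cost n c1 + 1
  | CLoop _ c1 => n * (cost n c1 + 6) + 3
  end.

Fixpoint pcost (c : cmd) : {poly nat} :=
  match c with
  | CSet _ e => (ecost e + 1)%:P
  | CStore e1 e2 => (ecost e1 + ecost e2 + 1)%:P
  | CSeq c1 c2 => pcost c1 + pcost c2
  | CWhen e c1 => (ecost e)%:P + pcost c1 + 1%N%:P
  | CLoop _ c1 => 'X * (pcost c1 + 6%N%:P) + 3%N%:P
  end%R.

Lemma horner_pcost (n : nat) (c : cmd) : ((pcost c).[n])%R = cost n c.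
Proof.
elim: c => [x e|e1 e2|c1 IH1 c2 IH2|e c1 IH1|x c1 IH1] /=.
- by rewrite hornerC.
- by rewrite hornerC.
- by rewrite hornerD IH1 IH2.
- by rewrite !hornerD !hornerC IH1.
- by rewrite hornerD hornerM hornerX hornerD IH1 !hornerC.
Qed.

Definition code_at (p : program) (k : nat) (c : program) : Prop :=
  exists a b, p = a ++ c ++ b /\ size a = k.

Lemma code_at_cat p k c1 c2 : code_at p k (c1 ++ c2) ->
  code_at p k c1 /\ code_at p (k + size c1) c2.
Proof.
move=> [a [b [-> <-]]]; split; first by exists a, (c2 ++ b); rewrite !catA.
by exists (a ++ c1), b; rewrite size_cat !catA.
Qed.

Lemma code_at_cons p k i c : code_at p k (i :: c) ->
  onth p k = Some i /\ code_at p k.+1 c.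
Proof.
move=> /(@code_at_cat _ _ [:: i])[[a [b [-> <-]]]]; rewrite addn1 => H.
by split=> //; rewrite onthE map_cat nth_cat size_map ltnn subnn.
Qed.

Definition steps (p : program) (T : nat) (s s' : state) : Prop :=
  exists2 t, t <= T & run p t s = s'.

Lemma steps_trans p T1 T2 s1 s2 s3 :
  steps p T1 s1 s2 -> steps p T2 s2 s3 -> steps p (T1 + T2) s1 s3.
Proof.
move=> [t1 le1 <-] [t2 le2 <-]; exists (t2 + t1); first by lia.
by rewrite /run iterD.
Qed.

Lemma steps_le p T1 T2 s1 s2 : T1 <= T2 -> steps p T1 s1 s2 -> steps p T2 s1 s2.
Proof. by move=> le [t ? <-]; exists t => //; lia. Qed.

Lemma steps_pc p T T' s k k' r m : steps p T s (State k r m) ->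
  T <= T' -> k = k' -> steps p T' s (State k' r m).
Proof. by move=> S le <-; apply: steps_le S. Qed.

Lemma steps1 p k i r m : onth p k = Some i ->
  steps p 1 (State k r m) (exec i (State k r m)).
Proof. by move=> E; exists 1 => //; rewrite /run /= /step /= E. Qed.

Definition keeps (d : nat) (r r' : nat -> nat) : Prop :=
  forall j, odd j || (j < d.*2) -> r' j = r j.

Lemma keeps_trans d r1 r2 r3 : keeps d r1 r2 -> keeps d r2 r3 -> keeps d r1 r3.
Proof. by move=> H1 H2 j Hj; rewrite H2 // H1. Qed.

Lemma keeps_leq d d' r1 r2 : d <= d' -> keeps d' r1 r2 -> keeps d r1 r2.
Proof. by move=> le H j Hj; apply: H; lia. Qed.

Lemma keeps_updr d i r r' x :
  d <= i -> keeps d r r' -> keeps d r (upd r' i.*2 x).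
Proof. by move=> le K j Hj; rewrite /upd; case: eqP => [E|_]; [lia|exact: K]. Qed.

Lemma keeps_upd d i r x : d <= i -> keeps d r (upd r i.*2 x).
Proof. by move=> le; apply: keeps_updr. Qed.

Definition vars_in (n : nat) (v r : nat -> nat) : Prop :=
  r 0 = n /\ forall x, r x.*2.+1 = v x.

Lemma vars_in_keeps n d v r r' :
  0 < d -> keeps d r r' -> vars_in n v r -> vars_in n v r'.
Proof.
move=> d0 K [H0 Hv]; split; first by rewrite K // double_gt0.
by move=> x; rewrite K //= ?odd_double.
Qed.

Lemma cexpr_correct n v e d k p r m :
    0 < d -> vars_in n v r -> code_at p k (cexpr d k e) ->
  exists r', [/\ steps p (ecost e) (State k r m)
                   (State (k + size (cexpr d k e)) r' m),
    r' d.*2 = eval n (v, m) e & keeps d r r'].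
Proof.
elim: e d k r => [c||x|e1 IH1 e2 IH2|e1 IH1 e2 IH2|a e1 IH1|e1 IH1
                 |e0 IH0 e1 IH1 e2 IH2] d k r d0 Hv /=.
- move=> /code_at_cons[Ek _]; exists (upd r d.*2 c); rewrite addn1.
  by split; [exact: (steps1 _ _ Ek)|rewrite /upd eqxx|exact: keeps_upd].
- move=> /code_at_cons[Ek _]; exists (upd r d.*2 (r 0)); rewrite addn1.
  split; [exact: (steps1 _ _ Ek)| |exact: keeps_upd].
  by rewrite /upd eqxx; case: Hv.
- move=> /code_at_cons[Ek _]; exists (upd r d.*2 (r x.*2.+1)); rewrite addn1.
  split; [exact: (steps1 _ _ Ek)| |exact: keeps_upd].
  by rewrite /upd eqxx; case: Hv.
- move=> /code_at_cat[C1 /code_at_cat[C2 /code_at_cons[E3 _]]].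
  have [r1 [S1 V1 K1]] := IH1 _ _ _ d0 Hv C1.
  have Hv1 := vars_in_keeps d0 K1 Hv.
  have [r2 [S2 V2 K2]] := IH2 _ _ _ (ltn0Sn d) Hv1 C2.
  exists (upd r2 d.*2 (r2 d.*2 + r2 d.+1.*2)); split.
  + apply: steps_trans (steps_trans S1 S2) _.
    by rewrite !size_cat /= addn1 !addnA addnS; exact: (steps1 _ _ E3).
  + rewrite /upd eqxx V2 K2 ?V1 //; lia.
  + apply: keeps_trans K1 _; apply: keeps_trans (keeps_leq (leqnSn d) K2) _.
    exact: keeps_upd.
- move=> /code_at_cat[C1 /code_at_cat[C2 /code_at_cons[E3 _]]].
  have [r1 [S1 V1 K1]] := IH1 _ _ _ d0 Hv C1.
  have Hv1 := vars_in_keeps d0 K1 Hv.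
  have [r2 [S2 V2 K2]] := IH2 _ _ _ (ltn0Sn d) Hv1 C2.
  exists (upd r2 d.*2 (r2 d.*2 - r2 d.+1.*2)); split.
  + apply: steps_trans (steps_trans S1 S2) _.
    by rewrite !size_cat /= addn1 !addnA addnS; exact: (steps1 _ _ E3).
  + rewrite /upd eqxx V2 K2 ?V1 //; lia.
  + apply: keeps_trans K1 _; apply: keeps_trans (keeps_leq (leqnSn d) K2) _.
    exact: keeps_upd.
- move=> /code_at_cat[C1 /code_at_cons[E1 /code_at_cons[E2 /code_at_cons[E3]]]].
  move=> /code_at_cons[E4 /code_at_cons[E5 /code_at_cons[E6 _]]].
  have [r1 [S1 V1 K1]] := IH1 _ _ _ d0 Hv C1.
  have S2 : steps p 6 _ _ :=
    steps_trans (steps1 r1 m E1) (steps_trans (steps1 _ _ E2)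
   (steps_trans (steps1 _ _ E3) (steps_trans (steps1 _ _ E4)
   (steps_trans (steps1 _ _ E5) (steps1 _ _ E6))))).
  eexists; split.
  + apply: steps_trans S1 _; rewrite size_cat /= !addnS addn0.
    exact: S2.
  + rewrite /upd !eqxx.
    have -> : (d.*2 == d.+1.*2) = false by lia.
    by rewrite V1; lia.
  + by apply: keeps_trans K1 _; do 6!apply: keeps_updr => //.
- move=> /code_at_cat[C1 /code_at_cons[E1 _]].
  have [r1 [S1 V1 K1]] := IH1 _ _ _ d0 Hv C1.
  exists (upd r1 d.*2 (m (r1 d.*2))); split.
  + by apply: steps_trans S1 _; rewrite size_cat /= addn1 addnS; exact: (steps1 _ _ E1).
  + by rewrite /upd eqxx V1.
  + by apply: keeps_trans K1 _; exact: keeps_upd.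
- move=> /code_at_cat[C0 /code_at_cons[E0 /code_at_cat[C1 /code_at_cons[E1 C2]]]].
  have [r0 [S0 V0 K0]] := IH0 _ _ _ d0 Hv C0.
  have Hv0 := vars_in_keeps d0 K0 Hv.
  have SJ := steps1 r0 m E0.
  rewrite /= V0 in SJ; rewrite size_cat /= size_cat /=.
  case: ifP => N0.
  + rewrite (negbTE N0) in SJ.
    have [r1 [S1 V1 K1]] := IH1 _ _ _ d0 Hv0 C1.
    exists r1; split=> //; last exact: keeps_trans K0 K1.
    have SE := steps_trans S0 (steps_trans SJ (steps_trans S1 (steps1 r1 m E1))).
    by apply: steps_pc SE _ _; lia.
  + rewrite (negbFE N0) in SJ.
    have [r2 [S2 V2 K2]] := IH2 _ _ _ d0 Hv0 C2.
    exists r2; split=> //; last exact: keeps_trans K0 K2.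
    have SE := steps_trans S0 (steps_trans SJ S2).
    by apply: steps_pc SE _ _; lia.
Qed.

Definition keeps_temp (h : nat) (r r' : nat -> nat) : Prop :=
  forall j, j < h -> r' j.*2 = r j.*2.

Lemma keeps_temp_trans h r1 r2 r3 :
  keeps_temp h r1 r2 -> keeps_temp h r2 r3 -> keeps_temp h r1 r3.
Proof. by move=> H1 H2 j Hj; rewrite H2 // H1. Qed.

Lemma keepsW h r r' : keeps h r r' -> keeps_temp h r r'.
Proof. by move=> K j Hj; apply: K; rewrite ltn_double Hj orbT. Qed.

Lemma vars_in_setv n (s : store) r x i :
  vars_in n s.1 r -> vars_in n (setv s x i).1 (upd r x.*2.+1 i).
Proof.
move=> [H0 Hx]; split=> [|y]; first by rewrite /upd.
by rewrite /setv /= /upd eqSS (inj_eq double_inj); case: eqP => // _; exact: Hx.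
Qed.

Lemma keeps_temp_setv h r x i : keeps_temp h r (upd r x.*2.+1 i).
Proof. by move=> j _; rewrite /upd; case: eqP => // E; lia. Qed.

Lemma ccmd_correct n c h k p r s :
    0 < h -> vars_in n s.1 r -> code_at p k (ccmd h k c) ->
  exists r', [/\ steps p (cost n c) (State k r s.2)
                   (State (k + size (ccmd h k c)) r' (ev n c s).2),
    vars_in n (ev n c s).1 r' & keeps_temp h r r'].
Proof.
elim: c h k r s => [x e|e1 e2|c1 IH1 c2 IH2|e c1 IH1|x c1 IH1]
  h k r [v m] h0 /= Hv.
- move=> /code_at_cat[C1 /code_at_cons[E1 _]].
  have [r1 [S1 V1 K1]] := cexpr_correct m h0 Hv C1.
  have Hv1 := vars_in_keeps h0 K1 Hv.
  exists (upd r1 x.*2.+1 (r1 h.*2)); split.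
  + by apply: steps_trans S1 _; rewrite size_cat /= addn1 addnS; exact: (steps1 _ _ E1).
  + by rewrite V1; apply: (@vars_in_setv _ (v, m)).
  + apply: keeps_temp_trans (keepsW K1) _; exact: keeps_temp_setv.
- move=> /code_at_cat[C1 /code_at_cat[C2 /code_at_cons[E3 _]]].
  have [r1 [S1 V1 K1]] := cexpr_correct m h0 Hv C1.
  have Hv1 := vars_in_keeps h0 K1 Hv.
  have [r2 [S2 V2 K2]] := cexpr_correct m (ltn0Sn h) Hv1 C2.
  exists r2; split.
  + apply: steps_trans (steps_trans S1 S2) _.
    rewrite !size_cat /= addn1 !addnA addnS -V1 -V2 -(K2 h.*2); last by lia.
    exact: (steps1 _ _ E3).
  + exact: vars_in_keeps (ltn0Sn h) K2 Hv1.
  + apply: keeps_temp_trans (keepsW K1) _.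
    exact: keepsW (keeps_leq (leqnSn h) K2).
- move=> /code_at_cat[C1 C2].
  have [r1 [S1 V1 K1]] := IH1 _ _ _ (v, m) h0 Hv C1.
  have [r2 [S2 V2 K2]] := IH2 _ _ _ (ev n c1 (v, m)) h0 V1 C2.
  exists r2; split=> //; last exact: keeps_temp_trans K1 K2.
  by rewrite size_cat addnA; apply: steps_trans S1 S2.
- move=> /code_at_cat[C0 /code_at_cons[E0 C1]].
  have [r0 [S0 V0 K0]] := cexpr_correct m h0 Hv C0.
  have Hv0 := vars_in_keeps h0 K0 Hv.
  have SJ := steps1 r0 m E0.
  rewrite /= V0 in SJ; rewrite size_cat /=.
  case: ifP => N0.
  + rewrite (negbTE N0) in SJ.
    have [r1 [S1 V1 K1]] := IH1 _ _ _ (v, m) h0 Hv0 C1.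
    exists r1; split=> //; last exact: keeps_temp_trans (keepsW K0) K1.
    have SE := steps_trans S0 (steps_trans SJ S1).
    by apply: steps_pc SE _ _; lia.
  + rewrite (negbFE N0) in SJ.
    exists r0; split=> //; last exact: keepsW.
    by apply: steps_pc (steps_trans S0 SJ) _ _; lia.
- move=> /code_at_cons[E0 /code_at_cons[E1 /code_at_cons[E2 /code_at_cons[E3]]]].
  move=> /code_at_cat[]; rewrite -[k.+4]addn4 => C1.
  move=> /code_at_cons[E4 /code_at_cons[E5 /code_at_cons[E6 _]]].
  set p1 := ccmd _ _ _ in E2 C1 E4 E5 E6 *.
  pose F i (s : store) := ev n c1 (setv s x i).
  have loop i : i <= n -> exists r', [/\
      steps p (i * (cost n c1 + 6) + 1) (State k r m)
        (State k.+1 r' (iteri i F (v, m)).2),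
      vars_in n (iteri i F (v, m)).1 r', keeps_temp h r r' & r' h.*2 = i].
    elim: i => [|i IHi] le_i.
      exists (upd r h.*2 0); split; first exact: (steps1 _ _ E0).
      - by apply: vars_in_keeps h0 _ Hv; exact: keeps_upd.
      - by apply: keepsW; exact: keeps_upd.
      - by rewrite /upd eqxx.
    have [r1 [S1 V1 K1 H1]] := IHi (ltnW le_i).
    move: S1 V1; set s1 := iteri i F (v, m) => S1 V1.
    have [V10 V1x] := V1.
    have T1 := steps1 r1 s1.2 E1.
    rewrite /= V10 H1 in T1; set r2 := upd r1 _ _ in T1.
    have T2 := steps1 r2 s1.2 E2.
    rewrite /= in T2.
    have NZ : r2 h.+1.*2 == 0 = false by rewrite /r2 /upd eqxx; lia.
    rewrite NZ in T2.
    have T3 := steps1 r2 s1.2 E3.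
    have H2 : r2 h.*2 = i by rewrite /r2 /upd; case: eqP => //; lia.
    have K2 : keeps h r1 r2 by apply: keeps_upd.
    rewrite /= H2 -addn4 in T3; set r3 := upd r2 _ _ in T3.
    have V2 := vars_in_keeps h0 K2 V1.
    have V3 : vars_in n (setv s1 x i).1 r3 by apply: vars_in_setv.
    have [r4 [S4 V4 K4]] := IH1 _ _ _ _ (ltn0Sn h) V3 C1.
    have H4 : r4 h.*2 = i.
      by rewrite K4 // /r3 /upd; case: eqP => [|_]; [lia | exact: H2].
    have T4 := steps1 r4 (F i s1).2 E4.
    have T5 := steps1 (upd r4 h.+1.*2 1) (F i s1).2 E5.
    rewrite /= in T4 T5; set r6 := upd (upd r4 h.+1.*2 1) h.*2 _ in T5.
    have T6 := steps1 r6 (F i s1).2 E6.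
    exists r6; split.
    + have SE := steps_trans S1 (steps_trans T1 (steps_trans T2
        (steps_trans T3 (steps_trans S4 (steps_trans T4
          (steps_trans T5 T6)))))).
      rewrite /= in SE.
      by apply: steps_pc SE _ _; lia.
    + apply: vars_in_keeps h0 _ V4; do 2!apply: keeps_updr => //.
    + apply: keeps_temp_trans K1 _; apply: keeps_temp_trans (keepsW K2) _.
      apply: (@keeps_temp_trans _ _ r3); first exact: keeps_temp_setv.
      apply: (@keeps_temp_trans _ _ r4); first by move=> j ltj; apply: K4; lia.
      by apply: keepsW; do 2!apply: keeps_updr => //.
    + rewrite /r6 {1}/upd eqxx /upd eqxx H4.
      by case: eqP => [|_]; [lia | rewrite addn1].
  have [r1 [S1 [V10 V1x] K1 H1]] := loop n (leqnn n).
  have T1 := steps1 r1 (iteri n F (v, m)).2 E1.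
  rewrite /= V10 H1 subnn in T1; set r2 := upd r1 _ _ in T1.
  have T2 := steps1 r2 (iteri n F (v, m)).2 E2.
  rewrite /= {2}/r2 /upd eqxx /= in T2.
  exists r2; split.
  - by apply: steps_pc (steps_trans S1 (steps_trans T1 T2)) _ _ => //=;
      rewrite ?size_cat /=; lia.
  - by apply: vars_in_keeps h0 _ (conj V10 V1x); exact: keeps_upd.
  - by apply: keeps_temp_trans K1 _; apply: keepsW; exact: keeps_upd.
Qed.

(** * Auctions and bipartite vertex covers *)

Section Auction.
Variables (n : nat) (E : rel 'I_n).

(* [o v = u.+1] means that the column [v] is owned by the row [u]. *)
Record auction (p o : 'I_n -> nat) : Prop := Auction {
  auction_le : forall v, p v <= n;
  auction_owned : forall v, 0 < p v -> exists u : 'I_n, o v = u.+1;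
  auction_edge : forall u v : 'I_n, o v = u.+1 -> E u v;
  auction_cheap : forall u v v' : 'I_n, o v = u.+1 -> E u v' -> p v <= (p v').+1;
  auction_inj : forall u v v' : 'I_n, o v = u.+1 -> o v' = u.+1 -> v = v'
}.

Definition settled (p o : 'I_n -> nat) (u : 'I_n) : Prop :=
  (exists v, o v = u.+1) \/ (forall v, E u v -> n <= p v).

Lemma auction_init (p o : 'I_n -> nat) :
  (forall v, p v = 0) -> (forall v, o v = 0) -> auction p o.
Proof. by move=> p0 o0; split=> [v|v|u v|u v v'|u v v']; rewrite ?p0 ?o0. Qed.

Lemma auction_bid (p o p' o' : 'I_n -> nat) (u b : 'I_n) :
    auction p o -> (forall v, o v <> u.+1) -> E u b -> p b < n ->
    (forall v, E u v -> p b <= p v) ->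
    p' b = (p b).+1 -> o' b = u.+1 ->
    (forall v, v != b -> p' v = p v) -> (forall v, v != b -> o' v = o v) ->
  auction p' o'.
Proof.
move=> [le ow ed ch inj] no Eub ltb mnb p'b o'b p'v o'v.
have pp v : p v <= p' v.
  by have [->|/p'v ->] := eqVneq v b; rewrite ?p'b.
split=> [v|v|w v|w v v'|w v v'].
- by have [->|/p'v ->] := eqVneq v b; rewrite ?p'b.
- have [-> _|nb] := eqVneq v b; first by exists u.
  by rewrite p'v // o'v //; apply: ow.
- have [->|nb] := eqVneq v b; last by rewrite o'v //; apply: ed.
  by rewrite o'b => -[/val_inj <-].
- have [->|nb] := eqVneq v b.
    rewrite o'b p'b => -[/val_inj <-] Ev'.
    by rewrite ltnS; apply: leq_trans (mnb _ Ev') _.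
  rewrite o'v // p'v // => ov Ev'.
  by apply: leq_trans (ch _ _ _ ov Ev') _; rewrite ltnS.
- have [->|nb] := eqVneq v b; have [->|nb'] := eqVneq v' b => //.
  + by rewrite o'b o'v // => -[/val_inj <-] /no.
  + by rewrite o'b o'v // => ov [uw]; case: (no v); rewrite uw.
  + by rewrite !o'v //; apply: inj.
Qed.

Definition vertex_cover (C : {set 'I_n}) : Prop :=
  forall u v, E u v -> (u \in C) || (v \in C).

Definition price_cover (p : 'I_n -> nat) (k : nat) : {set 'I_n} :=
  [set v | (k < p v) || [exists w, E v w && (p w <= k)]].

Lemma price_cover_is_cover p k : vertex_cover (price_cover p k).
Proof.
move=> u v Euv; rewrite !inE; case: (leqP (p v) k) => [le|_].
  by apply/orP; left; apply/orP; right; apply/existsP; exists v; rewrite Euv.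
by rewrite /= orbT.
Qed.

(* Some price between 1 and n is not taken, because some column is free.      *)
(* Below that gap every row of an edge owns a column, also below the gap.     *)
Lemma price_cover_min (p o : 'I_n -> nat) :
    0 < n -> (forall u v w, E u v -> ~~ E v w) ->
    auction p o -> (forall u, settled p o u) ->
  exists k : 'I_n,
    forall C, vertex_cover C -> #|price_cover p k| <= #|C|.
Proof.
move=> n0 bip A st.
have [v0 pv0] : exists v0, p v0 = 0.
  pose z := Ordinal n0; have [pz|pz] := posnP (p z); first by exists z.
  have [u ou] := auction_owned A pz; exists u.
  have [//|pu] := posnP (p u); have [w ow] := auction_owned A pu.
  by have := bip _ _ z (auction_edge A ow); rewrite (auction_edge A ou).
have [k gap] : exists k : 'I_n, forall v, p v != k.+1.
  have [/existsP[k /forallP]|] := boolP [exists k : 'I_n, forall v, p v != k.+1].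
    by exists k.
  move=> /existsPn full.
  have /fin_all_exists[f fE] : forall k : 'I_n, exists v, p v = k.+1.
    by move=> k; have /forallPn[v] := full k; rewrite negbK => /eqP; exists v.
  have f_inj : injective f.
    by move=> i j fij; apply/val_inj; have := fE i; rewrite fij fE => -[].
  have [g _ gK] := injF_bij f_inj.
  by have := fE (g v0); rewrite gK pv0.
exists k => C cov.
pose M := [set v | [exists u : 'I_n, o v == u.+1]].
have owner v : exists u : 'I_n, v \in M -> o v = u.+1.
  have [|] := boolP (v \in M); last by exists v.
  by rewrite inE => /existsP[u /eqP]; exists u.
have {owner}[own ownE] := fin_all_exists owner.
have MP (u v : 'I_n) : o v = u.+1 -> v \in M.
  by move=> ov; rewrite inE; apply/existsP; exists u; apply/eqP.
have leM : #|price_cover p k| <= #|M|.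
  have /fin_all_exists[g gE] : forall c, exists v, c \in price_cover p k ->
      v \in M /\ if k < p c then v = c else o v = c.+1 /\ p v <= k.
    move=> c; have [|] := boolP (c \in price_cover p k); last by exists c.
    rewrite inE; case: ltnP => [lt _|le /existsP[w /andP[Ecw lew]]].
      exists c => _; split=> //.
      have [|u] := auction_owned A (v := c); first exact: leq_trans lt.
      exact: MP.
    have [[v ov]|dead] := st c; last by have := dead _ Ecw; have := ltn_ord k; lia.
    exists v => _; split; first exact: MP ov.
    split=> //; have := auction_cheap A ov Ecw.
    by have := gap v; lia.
  rewrite -(card_in_imset (f := g)) => [|c d Cc Cd gcd].
    by apply/subset_leq_card/fintype.subsetP => _ /imsetP[c /gE[Mc _] ->].
  have [_] := gE _ Cc; have [_] := gE _ Cd; rewrite gcd.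
  case: ltnP => [lt|le]; case: ltnP => [lt'|le'].
  - by move=> -> ->.
  - by move=> -> [_]; rewrite leqNgt lt.
  - by move=> [_ le1] E1; move: lt'; rewrite ltnNge -E1 le1.
  - by move=> [od _] [oc _]; apply/val_inj; move: od; rewrite oc => -[].
apply: leq_trans leM _.
pose f v := if v \in C then v else own v.
rewrite -(card_in_imset (f := f) (D := mem M)) => [|v w Mv Mw].
  apply/subset_leq_card/fintype.subsetP => _ /imsetP[v Mv ->]; rewrite /f.
  case: ifP => // nC; have := cov _ _ (auction_edge A (ownE _ Mv)).
  by rewrite nC orbF.
have Ev := auction_edge A (ownE _ Mv); have Ew := auction_edge A (ownE _ Mw).
rewrite /f; case: ifP => _; case: ifP => _ // eq.
- by have := bip _ _ w Ev; rewrite eq Ew.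
- by have := bip _ _ v Ew; rewrite -eq Ev.
- by apply: (auction_inj A (ownE _ Mv)); rewrite eq; apply: ownE.
Qed.

End Auction.

(** * Split partitions by degree *)

Definition degree (T : finType) (G : sgraph T) (v : T) : nat :=
  #|[set w | G v w]%SET|.

Definition split_partition (T : finType) (G : sgraph T) (K : {set T}) : Prop :=
  clique G K /\ independent G (~: K).

Definition high_degree (T : finType) (G : sgraph T) (t : nat) : {set T} :=
  [set v | t <= degree G v]%SET.

(* With K minimal every vertex of K has a neighbour outside, so its degree is *)
(* at least |K|; the vertices outside K of degree |K| are those adjacent to   *)
(* all of K, and it matters only whether there are 0, 1 or more of them.      *)
Lemma split_partition_high_degree (T : finType) (G : sgraph T) :
    split_graph G -> 0 < #|T| ->
  exists2 t, t < #|T| & split_partition G (high_degree G t).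
Proof.
move=> [K0 split0] T0.
pose P (K : {set T}) := `[< split_partition G K >].
have PK0 : P K0 by apply/asboolP.
case: (arg_minnP (fun K : {set T} => #|K|) PK0) => K /asboolP[cK iK] minK.
have out v : v \in K -> exists2 w, w \notin K & G v w.
  move=> vK; apply/exists2P; apply: contrapT => nex.
  have nG w : w \notin K -> ~~ G v w.
    by move=> nw; apply/negP => Gvw; apply: nex; exists w.
  have : P (K :\ v).
    apply/asboolP; split=> a b.
      by rewrite !inE => /andP[_ aK] /andP[_ bK]; apply: cK.
    rewrite !inE !negb_and !negbK.
    case/orP=> [/eqP->|aK]; case/orP=> [/eqP->|bK].
    + by rewrite adj_irrefl.
    + exact: nG.
    + by rewrite adj_sym; apply: nG.
    + by apply: iK; rewrite inE.
  by move=> /minK; rewrite (cardsD1 v K) vK ltnn.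
have nbrI u w : u \notin K -> G u w -> w \in K.
  move=> uK Guw; apply: contraLR Guw => wK.
  by apply: iK; rewrite inE.
have degK v : v \in K -> #|K| <= degree G v.
  move=> vK; have [w wK Gvw] := out v vK.
  have -> : #|K| = #|w |: K :\ v|%SET.
    by rewrite cardsU1 (cardsD1 v) vK !inE (negbTE wK) andbF.
  apply/subset_leq_card/fintype.subsetP => a; rewrite !inE.
  by case/orP=> [/eqP->//|/andP[av aK]]; apply: cK; rewrite // eq_sym.
have degI u : u \notin K -> degree G u <= #|K|.
  by move=> uK; apply/subset_leq_card/fintype.subsetP => a; rewrite inE; apply: nbrI.
have degIlt u v : u \notin K -> v \in K -> ~~ G u v -> degree G u < #|K|.
  move=> uK vK nG; rewrite (cardsD1 v K) vK ltnS.
  apply/subset_leq_card/fintype.subsetP => a; rewrite !inE => Gua.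
  by rewrite (nbrI _ _ uK Gua) andbT; apply: contraNneq nG => <-.
have ltK u : u \notin K -> #|K| < #|T|.
  by move=> uK; rewrite -cardsT; apply: proper_card; rewrite properT;
    apply: contraNneq uK => ->; rewrite inE.
have [/existsP[u /andP[uK /forall_inP Gu]]|] :=
  boolP [exists u, (u \notin K) && [forall v in K, G u v]]; last first.
  move=> /existsPn none; exists #|K|.
    have [u _] : exists u : T, u \in T by apply/card_gt0P.
    by have [/out[w wK _]|] := boolP (u \in K); [exact: ltK wK|exact: ltK].
  suff -> : high_degree G #|K| = K by [].
  apply/setP => a; rewrite inE; have [aK|aK] := boolP (a \in K); first exact: degK.
  apply/negbTE; rewrite -ltnNge.
  have := none a; rewrite aK => /forallPn[v]; rewrite negb_imply => /andP[vK].
  exact: degIlt.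
have [/existsP[u' /and3P[u'K u'u /forall_inP Gu']]|] :=
  boolP [exists u', [&& u' \notin K, u' != u & [forall v in K, G u' v]]].
  have degK' v : v \in K -> #|K| < degree G v.
    move=> vK; have -> : #|K|.+1 = #|u |: (u' |: K :\ v)|%SET.
      rewrite /= !cardsU1 (cardsD1 v) vK !inE (negbTE uK) (negbTE u'K).
      by rewrite !andbF !orbF eq_sym u'u.
    apply/subset_leq_card/fintype.subsetP => a; rewrite !inE => /or3P[/eqP->|/eqP->|].
    - by rewrite adj_sym; apply: Gu.
    - by rewrite adj_sym; apply: Gu'.
    - by case/andP=> av aK; apply: cK; rewrite // eq_sym.
  exists #|K|.+1.
    rewrite -cardsT.
    have <- : #|u |: (u' |: K)|%SET = #|K|.+2.
      by rewrite !cardsU1 !inE (negbTE uK) (negbTE u'K) orbF eq_sym u'u.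
    by apply: subset_leq_card; apply: finset.subsetT.
  suff -> : high_degree G #|K|.+1 = K by [].
  apply/setP => a; rewrite inE; have [aK|aK] := boolP (a \in K); first exact: degK'.
  by apply/negbTE; rewrite -ltnNge ltnS degI.
move=> /existsPn uniq; exists #|K|; first exact: ltK uK.
have -> : high_degree G #|K| = (u |: K)%SET.
  apply/setP => a; rewrite !inE; have [aK|aK] := boolP (a \in K).
    by rewrite orbT degK.
  rewrite orbF; have [->|au] := eqVneq a u.
    by apply/subset_leq_card/fintype.subsetP => b bK; rewrite inE Gu.
  apply/negbTE; rewrite -ltnNge.
  have := uniq a; rewrite aK au => /forallPn[v]; rewrite negb_imply => /andP[vK].
  exact: degIlt.
split=> a b; rewrite !inE.
  case/orP=> [/eqP->|aK]; case/orP=> [/eqP->|bK]; rewrite ?eqxx //.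
  - by move=> _; apply: Gu.
  - by move=> _; rewrite adj_sym; apply: Gu.
  - exact: cK.
by rewrite !negb_or => /andP[_ aK] /andP[_ bK]; apply: iK; rewrite inE.
Qed.

(** * Unit interval models of split graphs *)

Import Order.TTheory GRing.Theory Num.Theory.

Lemma intervals_meet (R : realType) (l a b : R) : (0 < l)%R ->
  (`[a, (a + l)%R] `&` `[b, (b + l)%R] !=set0)%classic <-> (`|a - b| <= l)%R.
Proof.
move=> l0; rewrite ler_norml; split.
  by move=> [c []]; rewrite /= !in_itv /= => /andP[? ?] /andP[? ?]; apply/andP; split; lra.
move=> /andP[? ?]; exists (Num.max a b); split; rewrite /= in_itv /=; apply/andP.
  by split; rewrite ?le_max ?lexx // ge_max; apply/andP; split; lra.
by split; rewrite ?le_max ?lexx ?orbT // ge_max; apply/andP; split; lra.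
Qed.

Definition unit_model (R : realType) (T : finType) (G : sgraph T) (W : {set T})
    (l : R) (a : T -> R) : Prop :=
  (0 < l)%R /\
  {in W &, forall x y, x != y -> G x y = (`|a x - a y| <= l)%R}.

Lemma unit_interval_inducedP (R : realType) (T : finType) (G : sgraph T)
    (W : {set T}) :
  unit_interval_graph R (induced G W) <-> exists l a, @unit_model R T G W l a.
Proof.
split=> [[l [a [l0 H]]]|[l [a [l0 H]]]].
  exists l, (fun x => if insub x is Some x' then a x' else 0%R); split=> // x y xW yW xy.
  rewrite !insubT; have := H (Sub x xW) (Sub y yW).
  rewrite -val_eqE /= => /(_ xy) E; apply/idP/idP.
    by move=> /E /(intervals_meet _ _ l0).
  by move=> /(intervals_meet _ _ l0) /E.
exists l, (fun x => a (val x)); split=> // x y xy.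
have := H _ _ (valP x) (valP y) xy; rewrite /= /induced_adj => ->.
by split=> /(intervals_meet _ _ l0).
Qed.

Lemma dist_int_le (R : realType) (i j k : int) :
  (`|i%:~R - j%:~R| <= k%:~R :> R)%R = (`|i - j| <= k)%R.
Proof. by rewrite -rmorphB /= -intr_norm ler_int. Qed.

Section Deletion.
Variables (n : nat) (G : sgraph 'I_n) (K : {set 'I_n}).

Definition cross (u v : 'I_n) : bool := [&& u \notin K, v \in K & G u v].

(* In a split unit interval graph at most three independent vertices x, z, y  *)
(* (from left to right) have neighbours in the clique, and z is then adjacent *)
(* to all of it.  If [m] is false, x and y have no common neighbour, and a    *)
(* vertex [z] of [K] stands for an absent z; if [m] is true, there are only x *)
(* and y, and their neighbourhoods cover the clique.                          *)
Definition admissible (x y z : 'I_n) (m : bool) (v : 'I_n) : bool :=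
  if m then cross x v || cross y v
  else ((z \in K) || G z v) && ~~ (cross x v && cross y v).

Definition inadmissible x y z m : {set 'I_n} :=
  [set v in K | ~~ admissible x y z m v]%SET.

Definition live_row (x y z : 'I_n) (m : bool) (u : 'I_n) : bool :=
  [&& u \notin K, u != x, u != y & m || (u != z)].

Definition live_edge x y z m : rel 'I_n :=
  fun u v => [&& live_row x y z m u, (v \in K) && admissible x y z m v & G u v].

Lemma live_edge_bipartite x y z m u v w :
  live_edge x y z m u v -> ~~ live_edge x y z m v w.
Proof. by rewrite /live_edge /live_row => /and3P[_ /andP[-> _] _]. Qed.

Lemma deletion_sufficient (R : realType) x y z m (C : {set 'I_n}) :
    split_partition G K -> vertex_cover (live_edge x y z m) C ->
  unit_interval_graph R (del_vertices G (inadmissible x y z m :|: C)).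
Proof.
move=> [cK iK] cov; apply/unit_interval_inducedP.
pose f (u : 'I_n) : int :=
  (if m then
    if u \in K then
      if cross x u then if cross y u then 1 else 0 else 2
    else if u == x then -3 else if u == y then 5 else (u * 100 + 100)%N%:Z
  else
    if u \in K then if cross x u then 0 else if cross y u then 2 else 1
    else if u == z then 1 else if u == x then -4 else if u == y then 6
    else (u * 100 + 100)%N%:Z)%R.
pose W := (~: (inadmissible x y z m :|: C))%SET.
have adm u : u \in W -> u \in K -> admissible x y z m u.
  by rewrite !inE negb_or negb_and negbK => /andP[/orP[/negbTE->|]].
have dead u v : u \in W -> v \in W -> u \in K -> v \notin K ->
    live_row x y z m v -> G v u = false.
  move=> uW vW uK vK row; apply/negbTE/negP => Gvu.
  have := cov v u; rewrite /live_edge row Gvu uK adm //= => /(_ isT).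
  by move: uW vW; rewrite !inE => /norP[_ /negbTE->] /norP[_ /negbTE->].
have near_K u v : u \in K -> v \in K -> (`|f u - f v| <= 4)%R.
  by rewrite /f => -> ->; case: (m); do ?case: ifP => _.
have mixed u v : u \in W -> v \in W -> u \in K -> v \notin K ->
    G u v = (`|f u - f v| <= 4)%R.
  move=> uW vW uK vK; have := adm u uW uK; have := dead u v uW vW uK vK.
  rewrite (adj_sym G u v) /live_row /admissible /f uK (negbTE vK) /=.
  have cr w : w \notin K -> cross w u = G w u by rewrite /cross uK => ->.
  case: (m) => /=.
    have [vx _|vx] := eqVneq v x.
      rewrite -(cr v) // vx; case: (cross x u); case: (cross y u) => //.
    have [vy _|vy] := eqVneq v y.
      rewrite -(cr v) // vy; case: (cross x u); case: (cross y u) => //.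
    by move=> -> //; case: (cross x u); case: (cross y u) => //= _; lia.
  have [vz _|vz] := eqVneq v z.
    rewrite -vz (negbTE vK) /= => /andP[-> _].
    by case: (cross x u); case: (cross y u).
  have [vx _|vx] := eqVneq v x.
    rewrite -(cr v) // vx; case: (cross x u); case: (cross y u) => //; by rewrite andbF.
  have [vy _|vy] := eqVneq v y.
    rewrite -(cr v) // vy; case: (cross x u); case: (cross y u) => //; by rewrite andbF.
  by move=> -> //; case: (cross x u); case: (cross y u) => //= _; lia.
have far u v : u \notin K -> v \notin K -> u != v -> (4 < `|f u - f v|)%R.
  rewrite /f => /negbTE-> /negbTE-> uv.
  have uv' : u != v :> nat by [].
  case: (m); have [?|?] := eqVneq u x; have [?|?] := eqVneq v x;
    have [?|?] := eqVneq u y; have [?|?] := eqVneq v y;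
    try (have [?|?] := eqVneq u z; have [?|?] := eqVneq v z); subst;
    rewrite ?eqxx // in uv *; try lia.
exists 4%:~R%R, (fun u => (f u)%:~R)%R; split; first by rewrite ltr0n.
move=> u v uW vW uv; rewrite dist_int_le.
have [uK|uK] := boolP (u \in K); have [vK|vK] := boolP (v \in K).
- by rewrite near_K //; apply: cK.
- exact: mixed.
- by rewrite adj_sym distrC; apply: mixed.
- by rewrite leNgt far //=; apply/negbTE/iK; rewrite inE.
Qed.

Lemma unit_model_shape (R : realType) (W : {set 'I_n}) (l : R) (a : 'I_n -> R) :
    0 < n -> split_partition G K -> unit_model G W l a ->
  exists x y z m, {in W, forall v, v \in K -> admissible x y z m v} /\
    {in W &, forall u v, cross u v -> [|| u == x, u == y | ~~ m && (u == z)]}.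
Proof.
move=> n0 [cK iK] [l0 mod].
have [/existsP[k0 /andP[k0W k0K]]|/existsPn noK] :=
    boolP [exists k, (k \in W) && (k \in K)]; last first.
  pose w := Ordinal n0; exists w, w, w, true; split.
    by move=> v vW vK; have := noK v; rewrite vW vK.
  by move=> u v uW vW /and3P[_ vK _]; have := noK v; rewrite vW vK.
have crossK k : k \in K -> forall v, cross k v = false by rewrite /cross => ->.
pose Q u := (u \in W) && [exists v in W, cross u v].
have [/existsP[q0 Qq0]|/existsPn noQ] := boolP [exists u, Q u]; last first.
  exists k0, k0, k0, false; split.
    by move=> v vW vK; rewrite /admissible k0K crossK.
  move=> u v uW vW cuv; have := noQ u; rewrite /Q uW negb_exists_in.
  by move=> /forall_inP/(_ v vW); rewrite cuv.
have QW u : Q u -> u \in W by case/andP.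
have QK u : Q u -> u \notin K.
  by case/andP=> _ /existsP[v /andP[_ /and3P[]]].
have QI u v : u \in W -> v \in W -> cross u v -> Q u.
  by move=> uW vW c; rewrite /Q uW; apply/exists_inP; exists v.
have nbr u : Q u -> exists c, [/\ c \in W, c \in K & (`|a u - a c| <= l)%R].
  case/andP=> uW /exists_inP[c cW /and3P[uK cK' Guc]]; exists c; split=> //.
  by rewrite -mod //; apply: contraNneq uK => ->.
have near u v : u \in W -> v \in W -> u \in K -> v \in K -> (`|a u - a v| <= l)%R.
  move=> uW vW uK vK; have [->|uv] := eqVneq u v; first by rewrite subrr normr0 ltW.
  by rewrite -mod // cK.
have apart u v : Q u -> Q v -> u != v -> (l < `|a u - a v|)%R.
  move=> Qu Qv uv; rewrite ltNge -mod ?QW //; apply: iK; by rewrite inE QK.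
have crossE u v : Q u -> v \in W -> v \in K -> cross u v = (`|a u - a v| <= l)%R.
  move=> Qu vW vK; have uv : u != v.
    by apply/eqP => uv; have := QK _ Qu; rewrite uv vK.
  by rewrite /cross QK // vK /= mod // QW.
case: (arg_minP a Qq0) => x Qx minx; case: (arg_maxP a Qq0) => y Qy maxy'.
have maxy u : Q u -> (a u <= a y)%R by apply: maxy'.
have [xy|xy] := eqVneq x y.
  exists x, k0, k0, false; split.
    by move=> v vW vK; rewrite /admissible k0K (crossK k0) // andbF.
  move=> u v uW vW /(QI _ _ uW vW) Qu; apply/orP; left; apply: contraT => ux.
  have := apart _ _ Qu Qx ux; have := minx _ Qu; have := maxy _ Qu; rewrite -xy.
  by move=> H1 H2; (have -> : a u = a x by lra); rewrite subrr normr0 ltNge (ltW l0).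
have Lxy : (l < a y - a x)%R.
  have := apart _ _ Qx Qy xy; have := minx _ Qy.
  by rewrite lter_normr; lra.
have [cx [cxW cxK]] := nbr _ Qx; have [cy [cyW cyK]] := nbr _ Qy.
rewrite !ler_norml => Ny Nx.
have [/existsP[z /and3P[Qz zx zy]]|/existsPn no3] :=
    boolP [exists z, [&& Q z, z != x & z != y]].
  have Lxz : (l < a z - a x)%R.
    by have := apart _ _ Qz Qx zx; have := minx _ Qz; rewrite lter_normr; lra.
  have Lzy : (l < a y - a z)%R.
    by have := apart _ _ Qz Qy zy; have := maxy _ Qz; rewrite lter_normr; lra.
  exists x, y, z, false; split.
    move=> v vW vK; rewrite /admissible !crossE //; apply/andP; split.
      apply/orP; right.
      have : cross z v by rewrite crossE // ler_norml;
        have := near _ _ cxW vW cxK vK; have := near _ _ cyW vW cyK vK;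
        rewrite !ler_norml; lra.
      by case/and3P.
    by apply/negP => /andP[]; rewrite !ler_norml; lra.
  move=> u v uW vW /(QI _ _ uW vW) Qu; apply: contraT.
  rewrite !negb_or /= => /and3P[ux uy uz].
  have := near _ _ cxW cyW cxK cyK.
  have := apart _ _ Qu Qz uz; have := apart _ _ Qu Qx ux; have := apart _ _ Qu Qy uy.
  have := minx _ Qu; have := maxy _ Qu; rewrite !lter_normr ler_norml.
  by move=> ? ? /orP[?|?] /orP[?|?] /orP[?|?] ?; lra.
have two u v m : u \in W -> v \in W -> cross u v ->
    [|| u == x, u == y | ~~ m && (u == k0)].
  move=> uW vW /(QI _ _ uW vW) Qu; have := no3 u.
  by rewrite Qu /= negb_and !negbK => /orP[->|->]; rewrite ?orbT.
have [far|close] := ltP (l + l)%R (a y - a x)%R.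
  exists x, y, k0, false; split=> [v vW vK|u v uW vW]; last exact: two.
  rewrite /admissible k0K /= !crossE //.
  by apply/negP => /andP[]; rewrite !ler_norml; lra.
exists x, y, k0, true; split=> [v vW vK|u v uW vW]; last exact: two.
rewrite /admissible !crossE //; apply: contraT; rewrite negb_or -!ltNge.
have := near _ _ cxW vW cxK vK; have := near _ _ cyW vW cyK vK.
rewrite !ler_norml !lter_normr => ? ? /andP[/orP[?|?] /orP[?|?]]; lra.
Qed.

Lemma deletion_necessary (R : realType) (S : {set 'I_n}) :
    0 < n -> split_partition G K -> unit_interval_graph R (del_vertices G S) ->
  exists x y z m, inadmissible x y z m \subset S /\
    vertex_cover (live_edge x y z m) (S :\: inadmissible x y z m).
Proof.
move=> n0 sp /unit_interval_inducedP[l [a mod]].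
have [x [y [z [m [adm lim]]]]] := unit_model_shape n0 sp mod.
exists x, y, z, m; split.
  apply/fintype.subsetP => v; rewrite inE => /andP[vK]; apply: contraR => vS.
  by apply: adm; rewrite ?inE.
move=> u v /and3P[/and4P[uK ux uy uz] /andP[vK vA] Guv]; rewrite !inE.
rewrite (negbTE uK) vA andbF /=; apply: contraT; rewrite negb_or => /andP[uS vS].
have := lim u v; rewrite !inE /cross uK vK Guv => /(_ uS vS isT).
by rewrite (negbTE ux) (negbTE uy) /= => /andP[/negbTE mF uz']; rewrite mF uz' in uz.
Qed.

End Deletion.

(** * Reasoning about programs *)

Definition ENot e := EIf e (EConst 0) (EConst 1).
Definition EAnd e1 e2 := EIf e1 e2 (EConst 0).
Definition EOr e1 e2 := EIf e1 (EConst 1) e2.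
Definition ELt e1 e2 := ESub e2 e1.
Definition EEq e1 e2 := ENot (EAdd (ESub e1 e2) (ESub e2 e1)).
Definition ERd a e := ELoad (EAddr a e).
Definition CWr a e1 e2 := CStore (EAddr a e1) e2.

Definition arr (s : store) (a i : nat) : nat := s.2 (16 * i + a).

Definition written_vars : cmd -> seq nat :=
  fix wv c := match c with
  | CSet x _ => [:: x]
  | CStore _ _ => [::]
  | CSeq c1 c2 => wv c1 ++ wv c2
  | CWhen _ c1 => wv c1
  | CLoop x c1 => x :: wv c1
  end.

(* A store to a raw address, or to an array above 15, may hit any array. *)
Definition written_arrays : cmd -> seq nat :=
  fix wa c := match c with
  | CSet _ _ => [::]
  | CStore (EAddr a _) _ => if a < 16 then [:: a] else iota 0 16
  | CStore _ _ => iota 0 16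
  | CSeq c1 c2 => wa c1 ++ wa c2
  | CWhen _ c1 => wa c1
  | CLoop _ c1 => wa c1
  end.

Section Logic.
Variable n : nat.

Definition holds (s : store) (e : expr) : bool := eval n s e != 0.

Lemma holds_not s e : holds s (ENot e) = ~~ holds s e.
Proof. by rewrite /holds /=; case: (eval n s e). Qed.

Lemma holds_and s e1 e2 : holds s (EAnd e1 e2) = holds s e1 && holds s e2.
Proof. by rewrite /holds /=; case: (eval n s e1). Qed.

Lemma holds_or s e1 e2 : holds s (EOr e1 e2) = holds s e1 || holds s e2.
Proof. by rewrite /holds /=; case: (eval n s e1). Qed.

Lemma holds_if s e e1 e2 :
  holds s (EIf e e1 e2) = if holds s e then holds s e1 else holds s e2.
Proof. by rewrite /holds /=; case: (eval n s e). Qed.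

Lemma holds_lt s e1 e2 : holds s (ELt e1 e2) = (eval n s e1 < eval n s e2).
Proof. by rewrite /holds /= subn_eq0 ltnNge. Qed.

Lemma holds_eq s e1 e2 : holds s (EEq e1 e2) = (eval n s e1 == eval n s e2).
Proof. by rewrite holds_not /holds /=; lia. Qed.

Definition holdsE := (holds_not, holds_and, holds_or, holds_lt, holds_eq).

Lemma arr_write s a e1 e2 b i : a < 16 -> b < 16 ->
  arr (ev n (CWr a e1 e2) s) b i =
  if (b == a) && (i == eval n s e1) then eval n s e2 else arr s b i.
Proof.
move=> a16 b16; rewrite /arr /= /upd; case: ifP => [/eqP E|E].
  by have [-> ->] : b = a /\ i = eval n s e1 by [split; lia]; rewrite !eqxx.
by case: andP => // -[/eqP ba /eqP ie]; rewrite ba ie eqxx in E.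
Qed.

Lemma loop_ind x c s (I : nat -> store -> Prop) :
    I 0 s ->
    (forall (i : 'I_n) s', I i s' -> I i.+1 (ev n c (setv s' x i))) ->
  I n (ev n (CLoop x c) s).
Proof.
move=> I0 IS /=.
suff H i : i <= n -> I i (iteri i (fun i s' => ev n c (setv s' x i)) s) by exact: H.
elim: i => [//|i IHi] lt_i /=.
exact: (IS (Ordinal lt_i)) (IHi (ltnW lt_i)).
Qed.

Lemma var_frame c s x : x \notin written_vars c -> (ev n c s).1 x = s.1 x.
Proof.
elim: c s => [y e|e1 e2|c1 IH1 c2 IH2|e c1 IH1|y c1 IH1] s.
- by rewrite inE /= /upd => /negbTE->.
- by [].
- by rewrite mem_cat => /norP[n1 n2] /=; rewrite IH2 // IH1.
- by move=> n1 /=; case: ifP => // _; rewrite IH1.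
- rewrite inE => /norP[xy n1].
  apply: (loop_ind (I := fun _ s' => s'.1 x = s.1 x)) => // i s' <-.
  by rewrite IH1 //= /upd (negbTE xy).
Qed.

Lemma arr_frame c s a i : a < 16 -> a \notin written_arrays c ->
  arr (ev n c s) a i = arr s a i.
Proof.
move=> a16; have a_iota : a \in iota 0 16 by rewrite mem_iota.
elim: c s => [y e|e1 e2|c1 IH1 c2 IH2|e c1 IH1|y c1 IH1] s.
- by [].
- case: e1 => [c||x|e e'|e e'|b e|e|e e' e''];
    rewrite [written_arrays _]/= ?a_iota //.
  case: ifP => [b16|_]; last by rewrite a_iota.
  by rewrite inE => ab; rewrite (arr_write _ _ _ _ b16 a16) (negbTE ab).
- by rewrite mem_cat => /norP[n1 n2] /=; rewrite IH2 // IH1.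
- by move=> n1 /=; case: ifP => // _; rewrite IH1.
- move=> n1.
  apply: (loop_ind (I := fun _ s' => arr s' a i = arr s a i)) => // j s' <-.
  by rewrite IH1.
Qed.

Lemma loop_all x c f s (I : store -> Prop) (P : 'I_n -> bool) :
    f != x -> I s ->
    (forall (i : 'I_n) s', I s' -> I (ev n c (setv s' x i)) /\
      ((ev n c (setv s' x i)).1 f != 0) = (s'.1 f != 0) && P i) ->
  I (ev n (CLoop x c) s) /\
  ((ev n (CLoop x c) s).1 f != 0) = (s.1 f != 0) && [forall i, P i].
Proof.
move=> fx Is step.
have [Is' ->] : I (ev n (CLoop x c) s) /\ ((ev n (CLoop x c) s).1 f != 0) =
    (s.1 f != 0) && [forall i : 'I_n, (i < n) ==> P i].
  apply: (loop_ind (I := fun k s' => I s' /\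
    (s'.1 f != 0) = (s.1 f != 0) && [forall i : 'I_n, (i < k) ==> P i])).
    by split=> //; rewrite (_ : [forall i, _]) ?andbT //; apply/forallP.
  move=> i s' [Is' E]; have [Is'' ->] := step i s' Is'; split=> //.
  rewrite E -andbA; congr (_ && _); apply/andP/forallP.
    move=> [/forallP H Pi] j; apply/implyP; rewrite ltnS leq_eqVlt.
    by case/orP=> [/eqP/val_inj->//|ji]; exact: (implyP (H j)).
  move=> H; split; last exact: (implyP (H i)).
  apply/forallP => j; apply/implyP => ji; apply: (implyP (H j)).
  exact: leqW.
split=> //; congr (_ && _).
by apply: eq_forallb => i; rewrite ltn_ord.
Qed.

Lemma loop_min x0 x c s (I : store -> Prop) (F : 'I_n -> nat -> Prop) :
    x0 != x -> I s ->
    (forall (i : 'I_n) s', I s' ->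
      [/\ I (ev n c (setv s' x i)), (ev n c (setv s' x i)).1 x0 <= s'.1 x0 &
        forall b, F i b -> (ev n c (setv s' x i)).1 x0 <= b]) ->
  [/\ I (ev n (CLoop x c) s), (ev n (CLoop x c) s).1 x0 <= s.1 x0 &
    forall i b, F i b -> (ev n (CLoop x c) s).1 x0 <= b].
Proof.
move=> x0x Is step.
have [] : [/\ I (ev n (CLoop x c) s), (ev n (CLoop x c) s).1 x0 <= s.1 x0 &
    forall (i : 'I_n) b, i < n -> F i b -> (ev n (CLoop x c) s).1 x0 <= b].
  apply: (loop_ind (I := fun k s' => [/\ I s', s'.1 x0 <= s.1 x0 &
    forall (i : 'I_n) b, i < k -> F i b -> s'.1 x0 <= b])) => //.
  move=> i s' [Is' le Fs']; have [Is'' le' Fi] := step i s' Is'; split=> //.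
    exact: leq_trans le.
  move=> j b; rewrite ltnS leq_eqVlt => /orP[/eqP/val_inj->|ji]; first exact: Fi.
  by move=> Fj; apply: leq_trans le' _; apply: Fs' Fj.
by move=> ? ? H; split=> // i b; apply: H.
Qed.

End Logic.

(** * The program *)

Local Notation vt := 0.
Local Notation vx := 1.
Local Notation vy := 2.
Local Notation vz := 3.
Local Notation vm := 4.
Local Notation vu := 5.
Local Notation vv := 6.
Local Notation vk := 7.
Local Notation vacc := 8.
Local Notation vflag := 9.
Local Notation vbest := 10.
Local Notation vmin := 11.
Local Notation varg := 12.
Local Notation vi := 13.
Local Notation vj := 14.

Local Notation aAdj := 0.
Local Notation aRow := 1.
Local Notation aK := 2.
Local Notation aCol := 3.
Local Notation aLive := 4.
Local Notation aPrice := 5.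
Local Notation aOwner := 6.
Local Notation aCand := 7.
Local Notation aBest := 8.

Definition adj_e (e1 e2 : expr) : expr := ERd aAdj (EAdd (ERd aRow e1) e2).

(* The cells are moved from the last to the first, so that no cell is         *)
(* overwritten before it is read.                                             *)
Definition load_cmd : cmd :=
  CSeq (CLoop vi (CLoop vj (CSet vacc (EAdd (EVar vacc) (EConst 1)))))
 (CSeq (CLoop vi (CLoop vj
         (CSeq (CWr aAdj (EVar vacc) (ELoad (EVar vacc)))
               (CSet vacc (ESub (EVar vacc) (EConst 1))))))
 (CSeq (CSet vacc (EConst 1))
       (CLoop vi (CSeq (CWr aRow (EVar vi) (EVar vacc))
         (CLoop vj (CSet vacc (EAdd (EVar vacc) (EConst 1)))))))).

Definition high_cmd : cmd :=
  CLoop vu (CSeq (CSet vacc (EConst 0))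
    (CSeq (CLoop vv (CSet vacc (EAdd (EVar vacc) (adj_e (EVar vu) (EVar vv)))))
          (CWr aK (EVar vu) (ESub (EAdd (EVar vacc) (EConst 1)) (EVar vt))))).

Definition bad_pair_e : expr :=
  EIf (ERd aK (EVar vu))
    (EAnd (ERd aK (EVar vv))
      (EAnd (ENot (EEq (EVar vu) (EVar vv))) (ENot (adj_e (EVar vu) (EVar vv)))))
    (EAnd (ENot (ERd aK (EVar vv))) (adj_e (EVar vu) (EVar vv))).

Definition check_cmd : cmd :=
  CSeq (CSet vflag (EConst 1))
    (CLoop vu (CLoop vv (CWhen bad_pair_e (CSet vflag (EConst 0))))).

Definition cross_e (e : expr) : expr :=
  EAnd (ENot (ERd aK e)) (EAnd (ERd aK (EVar vv)) (adj_e e (EVar vv))).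

Definition admissible_e : expr :=
  EIf (EVar vm) (EOr (cross_e (EVar vx)) (cross_e (EVar vy)))
    (EAnd (EOr (ERd aK (EVar vz)) (adj_e (EVar vz) (EVar vv)))
          (ENot (EAnd (cross_e (EVar vx)) (cross_e (EVar vy))))).

Definition setup_cmd : cmd :=
  CLoop vv
 (CSeq (CWr aCol (EVar vv) (EAnd (ERd aK (EVar vv)) admissible_e))
 (CSeq (CWr aLive (EVar vv)
         (EAnd (ENot (ERd aK (EVar vv)))
         (EAnd (ENot (EEq (EVar vv) (EVar vx)))
         (EAnd (ENot (EEq (EVar vv) (EVar vy)))
               (EOr (EVar vm) (ENot (EEq (EVar vv) (EVar vz))))))))
 (CSeq (CWr aPrice (EVar vv) (EConst 0))
       (CWr aOwner (EVar vv) (EConst 0))))).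

Definition edge_e (e1 e2 : expr) : expr :=
  EAnd (ERd aLive e1) (EAnd (ERd aCol e2) (adj_e e1 e2)).

Definition owner_cmd : cmd :=
  CSeq (CSet vflag (EConst 1))
    (CLoop vv (CWhen (EEq (ERd aOwner (EVar vv)) (EAdd (EVar vu) (EConst 1)))
      (CSet vflag (EConst 0)))).

Definition cheapest_cmd : cmd :=
  CSeq (CSet vmin ENum)
    (CLoop vv (CWhen (EAnd (edge_e (EVar vu) (EVar vv))
                           (ELt (ERd aPrice (EVar vv)) (EVar vmin)))
      (CSeq (CSet vmin (ERd aPrice (EVar vv))) (CSet varg (EVar vv))))).

Definition bid_cmd : cmd :=
  CSeq owner_cmd (CSeq cheapest_cmd
    (CWhen (EAnd (EVar vflag) (ELt (EVar vmin) ENum))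
      (CSeq (CWr aOwner (EVar varg) (EAdd (EVar vu) (EConst 1)))
            (CWr aPrice (EVar varg) (EAdd (EVar vmin) (EConst 1)))))).

Definition sweep_cmd : cmd := CLoop vu bid_cmd.

Definition auction_cmd : cmd := CSeq (CLoop vi (CLoop vj sweep_cmd)) sweep_cmd.

Definition cand_cmd : cmd :=
  CSeq (CSet vacc (EConst 0))
 (CLoop vu
 (CSeq (CSet vflag (EConst 1))
 (CSeq (CWhen (EOr (EAnd (ERd aK (EVar vu)) (ENot (ERd aCol (EVar vu))))
                   (ELt (EVar vk) (ERd aPrice (EVar vu))))
         (CSet vflag (EConst 0)))
 (CSeq (CLoop vv (CWhen (EAnd (edge_e (EVar vu) (EVar vv))
                              (ENot (ELt (EVar vk) (ERd aPrice (EVar vv)))))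
         (CSet vflag (EConst 0))))
 (CSeq (CWr aCand (EVar vu) (ENot (EVar vflag)))
       (CSet vacc (EAdd (EVar vacc) (ENot (EVar vflag))))))))).

Definition keep_cmd : cmd :=
  CWhen (ELt (EVar vacc) (EVar vbest))
    (CSeq (CSet vbest (EVar vacc))
      (CLoop vv (CWr aBest (EVar vv) (ERd aCand (EVar vv))))).

Definition choose_cmd : cmd := CLoop vk (CSeq cand_cmd keep_cmd).

Definition shape_cmd : cmd := CSeq setup_cmd (CSeq auction_cmd choose_cmd).

Definition search_cmd : cmd :=
  CSeq (CSet vbest (EAdd ENum (EConst 1)))
  (CLoop vt (CSeq high_cmd (CSeq check_cmd (CWhen (EVar vflag)
    (CLoop vx (CLoop vy (CLoop vz
      (CSeq (CSeq (CSet vm (EConst 0)) shape_cmd)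
            (CSeq (CSet vm (EConst 1)) shape_cmd))))))))).

Definition output_cmd : cmd :=
  CLoop vv (CStore (EVar vv) (ERd aBest (EVar vv))).

Definition main_cmd : cmd := CSeq load_cmd (CSeq search_cmd output_cmd).

(* All registers are initially 0, so the first instruction loads n = M[0]. *)
Definition main_program : program := ILoad 0 1 :: ccmd 1 1 main_cmd.

(** * Correctness of the program *)

Section Correctness.
Variable n : nat.

Lemma ev_seq c1 c2 s : ev n (CSeq c1 c2) s = ev n c2 (ev n c1 s).
Proof. by []. Qed.

Lemma ev_when e c s :
  ev n (CWhen e c) s = if holds n s e then ev n c s else s.
Proof. by []. Qed.

Lemma ev_set x e s : ev n (CSet x e) s = setv s x (eval n s e).
Proof. by []. Qed.

Lemma arr_setv s x i a j : arr (setv s x i) a j = arr s a j.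
Proof. by []. Qed.

Lemma eval_rd s a e : eval n s (ERd a e) = arr s a (eval n s e).
Proof. by []. Qed.

Section Graph.
Variable G : sgraph 'I_n.

Definition graph_loaded (s : store) : Prop :=
  forall u v : 'I_n, arr s aAdj (arr s aRow u + v) = G u v.

Lemma eval_adj s e1 e2 (u v : 'I_n) : graph_loaded s ->
  eval n s e1 = u -> eval n s e2 = v -> eval n s (adj_e e1 e2) = G u v.
Proof. by move=> L E1 E2; rewrite -L -E1 -E2. Qed.

Lemma holds_adj s e1 e2 (u v : 'I_n) : graph_loaded s ->
  eval n s e1 = u -> eval n s e2 = v -> holds n s (adj_e e1 e2) = G u v.
Proof. by move=> L E1 E2; rewrite /holds (eval_adj L E1 E2) eqb0 negbK. Qed.

Lemma graph_loaded_frame c s : graph_loaded s ->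
    aAdj \notin written_arrays c -> aRow \notin written_arrays c ->
  graph_loaded (ev n c s).
Proof. by move=> L w0 w1 u v; rewrite !arr_frame. Qed.

Definition clique_loaded (K : {set 'I_n}) (s : store) : Prop :=
  forall v : 'I_n, (arr s aK v != 0) = (v \in K).

Lemma clique_loaded_frame K c s : clique_loaded K s ->
  aK \notin written_arrays c -> clique_loaded K (ev n c s).
Proof. by move=> L w v; rewrite arr_frame. Qed.

Lemma holds_clique K s e (v : 'I_n) : clique_loaded K s ->
  eval n s e = v -> holds n s (ERd aK e) = (v \in K).
Proof. by move=> L E; rewrite /holds eval_rd E L. Qed.

Lemma high_cmd_correct s : graph_loaded s ->
  clique_loaded (high_degree G (s.1 vt)) (ev n high_cmd s).
Proof.
move=> L.
suff: let s' := ev n high_cmd s in [/\ graph_loaded s', s'.1 vt = s.1 vt &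
    forall v : 'I_n, v < n -> (arr s' aK v != 0) = (v \in high_degree G (s.1 vt))].
  by case=> _ _ H v; apply: H.
apply: (loop_ind (I := fun i s' => [/\ graph_loaded s', s'.1 vt = s.1 vt &
  forall v : 'I_n, v < i ->
    (arr s' aK v != 0) = (v \in high_degree G (s.1 vt))])) => //.
move=> i s1 [L1 t1 H1].
rewrite ev_seq ev_set ev_seq; set s2 := setv _ vacc _; set c := CLoop vv _.
have [L3 E3] : graph_loaded (ev n c s2) /\ (ev n c s2).1 vacc = degree G i.
  suff [? ? ->] : let s' := ev n c s2 in
      [/\ graph_loaded s', s'.1 vu = i &
          s'.1 vacc = \sum_(w < n | w < n) G i w].
    split=> //; rewrite /degree cardE -sum1_size big_enum /= [RHS]big_mkcond.
    by apply: eq_big => [w|w _]; rewrite ?ltn_ord // inE; case: (G i w).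
  apply: (loop_ind (I := fun k s' => [/\ graph_loaded s', s'.1 vu = i &
    s'.1 vacc = \sum_(w < n | w < k) G i w])).
    by split=> //; rewrite big_pred0.
  move=> k s' [L' u' acc']; rewrite ev_set; split=> //.
  have E : eval n (setv s' vv k) (adj_e (EVar vu) (EVar vv)) = G i k.
    by apply: eval_adj.
  rewrite -[LHS]/(s'.1 vacc + eval n (setv s' vv k) (adj_e (EVar vu) (EVar vv))).
  rewrite E acc'.
  rewrite [RHS](bigD1 k) //= addnC; congr (_ + _); apply: eq_bigl => w.
  by rewrite -val_eqE /= ltnS; lia.
have E4 : (ev n c s2).1 vu = i by rewrite var_frame.
have E5 : (ev n c s2).1 vt = s.1 vt by rewrite var_frame.
split; first exact: graph_loaded_frame.
  by rewrite var_frame.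
move=> v; rewrite ltnS => le_v.
rewrite arr_write // eqxx andTb -[eval _ _ (EVar vu)]/((ev n c s2).1 vu) E4.
rewrite -[eval _ _ _]/((ev n c s2).1 vacc + 1 - (ev n c s2).1 vt) E3 E5.
have [->|ne] := eqVneq v i; first by rewrite eqxx inE; lia.
rewrite (_ : (v == i :> nat) = false); last exact: negbTE.
by rewrite arr_frame // H1 // ltn_neqAle le_v andbT.
Qed.

Lemma check_cmd_correct K s : graph_loaded s -> clique_loaded K s ->
  (ev n check_cmd s).1 vflag != 0 <-> split_partition G K.
Proof.
move=> L LK; rewrite ev_seq ev_set; set s1 := setv _ _ _.
pose bad u v := if u \in K then [&& v \in K, u != v & ~~ G u v]
                else (v \notin K) && G u v.
pose I s' := graph_loaded s' /\ clique_loaded K s'.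
pose Iu (u : 'I_n) s' := I s' /\ s'.1 vu = u.
set c1 := CLoop vv _.
have inner (u : 'I_n) s2 : Iu u s2 -> Iu u (ev n c1 s2) /\
    ((ev n c1 s2).1 vflag != 0) = (s2.1 vflag != 0) && [forall v, ~~ bad u v].
  move=> I2; apply: loop_all => // v s3 [[L3 K3] u3].
  set s4 := setv _ _ _; have L4 : graph_loaded s4 by [].
  have K4 : clique_loaded K s4 by [].
  have u4 : eval n s4 (EVar vu) = u by [].
  have v4 : eval n s4 (EVar vv) = v by [].
  have Eb : holds n s4 bad_pair_e = bad u v.
    rewrite /bad_pair_e holds_if !holdsE (holds_adj L4 u4 v4).
    by rewrite (holds_clique K4 u4) (holds_clique K4 v4) u4 v4.
  rewrite ev_when Eb; case: (bad u v); split=> //; by rewrite ?andbT ?andbF.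
have [_ ->] : I (ev n (CLoop vu c1) s1) /\ ((ev n (CLoop vu c1) s1).1 vflag != 0)
    = (s1.1 vflag != 0) && [forall u, [forall v, ~~ bad u v]].
  apply: loop_all => // u s2 I2.
  by have [[]] := inner u (setv s2 vu u) (conj I2 erefl).
rewrite /=; split.
  move=> /forallP H; split=> a b.
    move=> aK bK ab; have /forallP/(_ b) := H a.
    by rewrite /bad aK bK ab negbK.
  rewrite !inE => aK bK; have /forallP/(_ b) := H a.
  by rewrite /bad (negbTE aK) bK.
move=> [cK iK]; apply/forallP => a; apply/forallP => b; rewrite /bad.
case: ifPn => aK; apply/negP.
  by move=> /and3P[bK ab /negP]; apply; apply: cK.
by move=> /andP[bK]; apply/negP; apply: iK; rewrite inE.
Qed.

Section Shape.
Variables (K : {set 'I_n}) (x y z : 'I_n) (m : bool).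

Definition shape_set (s : store) : Prop :=
  [/\ s.1 vx = x, s.1 vy = y, s.1 vz = z & (s.1 vm != 0) = m].

Lemma shape_set_frame c s : shape_set s ->
  all [pred a | a \notin written_vars c] [:: vx; vy; vz; vm] ->
  shape_set (ev n c s).
Proof. by move=> [? ? ? ?] /and5P[/= ? ? ? ? _]; split; rewrite var_frame. Qed.

Lemma setup_cmd_correct s :
    graph_loaded s -> clique_loaded K s -> shape_set s ->
  forall v : 'I_n, let s' := ev n setup_cmd s in
  [/\ (arr s' aCol v != 0) = (v \in K) && admissible G K x y z m v,
      (arr s' aLive v != 0) = live_row K x y z m v,
      arr s' aPrice v = 0 & arr s' aOwner v = 0].
Proof.
move=> L LK Sh.
suff [_ _ _ H] : let s' := ev n setup_cmd s in
  [/\ graph_loaded s', clique_loaded K s', shape_set s' &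
  forall v : 'I_n, v < n ->
  [/\ (arr s' aCol v != 0) = (v \in K) && admissible G K x y z m v,
      (arr s' aLive v != 0) = live_row K x y z m v,
      arr s' aPrice v = 0 & arr s' aOwner v = 0]] by move=> v; apply: H.
apply: (loop_ind (I := fun i s' =>
  [/\ graph_loaded s', clique_loaded K s', shape_set s' &
  forall v : 'I_n, v < i ->
  [/\ (arr s' aCol v != 0) = (v \in K) && admissible G K x y z m v,
      (arr s' aLive v != 0) = live_row K x y z m v,
      arr s' aPrice v = 0 & arr s' aOwner v = 0]])) => // i s1 [L1 K1 Sh1 H1].
split.
- exact: graph_loaded_frame.
- exact: clique_loaded_frame.
- exact: shape_set_frame.
move=> v; rewrite ltnS => le_v.
rewrite !ev_seq; set s2 := setv _ _ _.
set s3 := ev n (CWr aCol _ _) s2; set s4 := ev n (CWr aLive _ _) s3.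
set s5 := ev n (CWr aPrice _ _) s4.
have E2 : s2.1 vv = i by []. 
have [->|vi'] := eqVneq v i; last first.
  have : v < i by rewrite ltn_neqAle le_v andbT.
  case/H1 => H3 H4 H5 H6.
  have vE : (v == s2.1 vv :> nat) = false by rewrite E2; apply/negbTE.
  by rewrite /s5 /s4 /s3 !arr_write //= vE.
have x2 : eval n s2 (EVar vx) = x by case: Sh1.
have y2 : eval n s2 (EVar vy) = y by case: Sh1.
have z2 : eval n s2 (EVar vz) = z by case: Sh1.
have m2 : holds n s2 (EVar vm) = m by case: Sh1.
have i2 : eval n s2 (EVar vv) = i by [].
have K2 : clique_loaded K s2 by [].
have L2 : graph_loaded s2 by [].
have K3 : clique_loaded K s3 by apply: clique_loaded_frame.
have m3 : holds n s3 (EVar vm) = m by [].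
have cr e (w : 'I_n) : eval n s2 e = w -> holds n s2 (cross_e e) = cross G K w i.
  by move=> E; rewrite !holdsE (holds_clique K2 E) (holds_clique K2 i2) (holds_adj L2 E i2).
split.
- rewrite arr_frame // /s5 arr_frame // /s4 arr_frame // /s3 arr_write //.
  rewrite eqxx i2 eqxx -/(holds n s2 _).
  rewrite /admissible_e holds_and holds_if (holds_clique K2 i2) m2.
  rewrite holds_or (cr _ _ x2) (cr _ _ y2).
  rewrite holds_and holds_or (holds_clique K2 z2) (holds_adj L2 z2 i2).
  by rewrite holds_not holds_and (cr _ _ x2) (cr _ _ y2).
- rewrite arr_frame // /s5 arr_frame // /s4 arr_write //.
  rewrite -[eval n s3 (EVar vv)]/(s2.1 vv) E2 !eqxx.
  rewrite -/(holds n s3 _) !holdsE (holds_clique (v := i) K3) // m3.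
  by rewrite -[eval n s3 (EVar vx)]/(eval n s2 (EVar vx)) x2
    -[eval n s3 (EVar vy)]/(eval n s2 (EVar vy)) y2
    -[eval n s3 (EVar vz)]/(eval n s2 (EVar vz)) z2.
- by rewrite arr_frame // /s5 arr_write // -[eval n s4 (EVar vv)]/(s2.1 vv) E2 !eqxx.
- by rewrite arr_write // -[eval n s5 (EVar vv)]/(s2.1 vv) E2 !eqxx.
Qed.

End Shape.
End Graph.
End Correctness.

Section AuctionProgram.
Variables (n : nat) (E : rel 'I_n).

Definition edges_loaded (s : store) : Prop := forall u v : 'I_n,
  [&& arr s aLive u != 0, arr s aCol v != 0 & arr s aAdj (arr s aRow u + v) != 0]
  = E u v.

Lemma edges_loaded_frame c s : edges_loaded s ->
    all [pred a | a \notin written_arrays c] [:: aLive; aCol; aAdj; aRow] ->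
  edges_loaded (ev n c s).
Proof. by move=> L /and5P[/= ? ? ? ? _] u v; rewrite !arr_frame. Qed.

Lemma holds_edge s e1 e2 (u v : 'I_n) : edges_loaded s ->
  eval n s e1 = u -> eval n s e2 = v -> holds n s (edge_e e1 e2) = E u v.
Proof. by move=> L E1 E2; rewrite !holdsE -L /holds !eval_rd /= E1 E2. Qed.

Definition prices (s : store) (v : 'I_n) : nat := arr s aPrice v.
Definition owners (s : store) (v : 'I_n) : nat := arr s aOwner v.

Lemma prices_frame c s : aPrice \notin written_arrays c ->
  prices (ev n c s) = prices s.
Proof. by move=> w; apply/funext => v; rewrite /prices arr_frame. Qed.

Lemma owners_frame c s : aOwner \notin written_arrays c ->
  owners (ev n c s) = owners s.
Proof. by move=> w; apply/funext => v; rewrite /owners arr_frame. Qed.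

Lemma owner_cmd_correct (s : store) (u : 'I_n) : s.1 vu = u ->
  ((ev n owner_cmd s).1 vflag != 0) = [forall v, owners s v != u.+1].
Proof.
move=> Eu; rewrite ev_seq ev_set; set s1 := setv _ _ _; set c := CWhen _ _.
have [_ ->] : (let s' := ev n (CLoop vv c) s1 in s'.1 vu = u /\ owners s' = owners s) /\
    ((ev n (CLoop vv c) s1).1 vflag != 0)
    = (s1.1 vflag != 0) && [forall v, owners s v != u.+1]; last by [].
apply: (loop_all (I := fun s' => s'.1 vu = u /\ owners s' = owners s)) => // v s2 [u2 o2].
set s3 := setv _ _ _.
have E3 : holds n s3 (EEq (ERd aOwner (EVar vv)) (EAdd (EVar vu) (EConst 1)))
    = (owners s v == u.+1).
  by rewrite holds_eq -o2 -[eval n s3 (EAdd _ _)]/(s2.1 vu + 1) u2 addn1.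
split; first by split; [rewrite var_frame | rewrite owners_frame].
by rewrite /c ev_when E3; case: (_ == u.+1); rewrite ?andbT ?andbF.
Qed.

Lemma cheapest_cmd_correct (s : store) (u : 'I_n) : edges_loaded s -> s.1 vu = u ->
  let s' := ev n cheapest_cmd s in
  (forall v, E u v -> s'.1 vmin <= prices s v) /\
  (s'.1 vmin = n \/ exists v : 'I_n,
     [/\ s'.1 varg = v, E u v & s'.1 vmin = prices s v]).
Proof.
move=> L Eu; rewrite /cheapest_cmd ev_seq ev_set; set s1 := setv _ _ _.
set c := CWhen _ _.
suff [_ [_ [_ [H ?]]]] : let s' := ev n (CLoop vv c) s1 in
  edges_loaded s' /\ s'.1 vu = u /\ prices s' = prices s /\
  (forall v : 'I_n, v < n -> E u v -> s'.1 vmin <= prices s v) /\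
  (s'.1 vmin = n \/ exists v : 'I_n,
     [/\ s'.1 varg = v, E u v & s'.1 vmin = prices s v]).
  by split=> // v; apply: H.
apply: (loop_ind (I := fun i s' =>
  edges_loaded s' /\ s'.1 vu = u /\ prices s' = prices s /\
  (forall v : 'I_n, v < i -> E u v -> s'.1 vmin <= prices s v) /\
  (s'.1 vmin = n \/ exists v : 'I_n,
     [/\ s'.1 varg = v, E u v & s'.1 vmin = prices s v]))).
  by do 4!split=> //; left.
move=> i s2 [L2 [u2 [p2 [min2 arg2]]]]; set s3 := setv _ _ _.
split; first exact: edges_loaded_frame.
split; first by rewrite var_frame.
split; first by rewrite prices_frame.
have E3 : holds n s3 (EAnd (edge_e (EVar vu) (EVar vv))
    (ELt (ERd aPrice (EVar vv)) (EVar vmin))) = E u i && (prices s i < s2.1 vmin).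
  by rewrite holds_and (holds_edge (u := u) (v := i)) // holds_lt -p2.
rewrite /c ev_when E3; case: andP => [[Eui lt]|nlt].
  rewrite ev_seq !ev_set.
  set s4 := setv (setv _ _ _) _ _.
  have -> : s4.1 vmin = prices s i by rewrite -p2.
  have -> : s4.1 varg = i by [].
  split; last by right; exists i.
  move=> v; rewrite ltnS leq_eqVlt => /orP[/eqP/val_inj->//|vi] Euv.
  exact: leq_trans (ltnW lt) (min2 v vi Euv).
split=> // v; rewrite ltnS leq_eqVlt => /orP[/eqP/val_inj->|vi] Euv.
  by rewrite leqNgt; apply/negP => lt; apply: nlt.
exact: min2.
Qed.

Lemma bid_cmd_correct (s : store) (u : 'I_n) : edges_loaded s -> s.1 vu = u ->
  let s' := ev n bid_cmd s in
  [/\ settled E (prices s) (owners s) u, prices s' = prices s & owners s' = owners s]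
  \/ exists b : 'I_n,
  [/\ forall v, owners s v <> u.+1, E u b /\ prices s b < n,
      forall v, E u v -> prices s b <= prices s v,
      prices s' b = (prices s b).+1 /\ owners s' b = u.+1 &
      forall v, v != b -> prices s' v = prices s v /\ owners s' v = owners s v].
Proof.
move=> L Eu; rewrite /bid_cmd !ev_seq.
set s1 := ev n owner_cmd s; set s2 := ev n cheapest_cmd s1.
have L1 : edges_loaded s1 by apply: edges_loaded_frame.
have u1 : s1.1 vu = u by rewrite var_frame.
have p1 : prices s1 = prices s by rewrite prices_frame.
have o1 : owners s1 = owners s by rewrite owners_frame.
have u2 : s2.1 vu = u by rewrite var_frame.
have p2 : prices s2 = prices s by rewrite prices_frame.
have o2 : owners s2 = owners s by rewrite owners_frame.
have f2 : (s2.1 vflag != 0) = [forall v, owners s v != u.+1].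
  by rewrite var_frame // (owner_cmd_correct Eu).
have [min2 arg2] := cheapest_cmd_correct L1 u1.
rewrite -/s2 p1 in min2 arg2; rewrite ev_when.
have -> : holds n s2 (EAnd (EVar vflag) (ELt (EVar vmin) ENum)) =
    [forall v, owners s v != u.+1] && (s2.1 vmin < n).
  by rewrite holds_and holds_lt -f2.
case: andP => [[/forallP free lt]|no]; last first.
  left; split=> //.
  have [/forallP free|/forallPn[v]] := boolP [forall v, owners s v != u.+1].
    right=> v /min2; apply: leq_trans; rewrite leqNgt; apply/negP => lt.
    by apply: no; split=> //; apply/forallP.
  by rewrite negbK => /eqP; left; exists v.
right; case: arg2 => [eq|[b [argb Eub minb]]]; first by rewrite eq ltnn in lt.
exists b; rewrite ev_seq; set s3 := ev n _ s2.
have arg3 : eval n s3 (EVar varg) = b by [].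
have val3 : eval n s3 (EAdd (EVar vmin) (EConst 1)) = (prices s b).+1.
  by rewrite -minb -[RHS]addn1.
have val2 : eval n s2 (EAdd (EVar vu) (EConst 1)) = u.+1.
  by rewrite -u2 -[RHS]addn1.
split.
- by move=> v; apply/eqP.
- by rewrite -minb.
- by move=> v /min2; rewrite minb.
- split; first by rewrite /prices arr_write // arg3 !eqxx val3.
  by rewrite /owners arr_frame // /s3 arr_write // val2 /= argb !eqxx.
- move=> v vb; have vbn : (v == b :> nat) = false by apply/negbTE.
  split; first by rewrite -p2 /prices arr_write // arg3 vbn andbF /s3 arr_frame.
  by rewrite -o2 /owners arr_frame // /s3 arr_write // /= argb vbn.
Qed.

Definition auction_state (s : store) : Prop :=
  edges_loaded s /\ auction E (prices s) (owners s).

Definition finished (s : store) : Prop :=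
  forall u, settled E (prices s) (owners s) u.

Definition revenue (s : store) : nat := \sum_v prices s v.

Lemma sweep_cmd_correct s k : auction_state s -> finished s \/ k <= revenue s ->
  let s' := ev n sweep_cmd s in
  auction_state s' /\ (finished s' \/ k < revenue s').
Proof.
move=> A0 H0.
suff [A1 [[p1 o1 H1]|[nf lt]]] : let s' := ev n sweep_cmd s in
    auction_state s' /\ (
    [/\ prices s' = prices s, owners s' = owners s &
       forall u : 'I_n, u < n -> settled E (prices s) (owners s) u] \/
    ~ finished s /\ revenue s < revenue s').
- by split=> //; left=> u; rewrite p1 o1; apply: H1.
- by split=> //; right; case: H0 => // le; apply: leq_ltn_trans lt.
apply: (loop_ind (I := fun i s' => auction_state s' /\ (
    [/\ prices s' = prices s, owners s' = owners s &
       forall u : 'I_n, u < i -> settled E (prices s) (owners s) u] \/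
    ~ finished s /\ revenue s < revenue s'))).
  by split=> //; left.
move=> i s2 [[L2 A2] H2]; set s3 := setv _ _ _.
have L3 : edges_loaded s3 by [].
have L4 : edges_loaded (ev n bid_cmd s3) by apply: edges_loaded_frame.
have [[st p4 o4]|] := bid_cmd_correct L3 (erefl _ : s3.1 vu = i).
  split; first by rewrite /auction_state p4 o4.
  case: H2 => [[p2 o2 H2]|H2]; last by right; rewrite /revenue p4.
  left; rewrite p4 o4; split=> // v; rewrite ltnS leq_eqVlt.
  by case/orP=> [/eqP/val_inj->|]; [rewrite -p2 -o2 | exact: H2].
move=> [b [free [Eb ltb] minb [pb ob] other]].
split.
  split=> //; apply: (auction_bid A2 free Eb ltb minb pb ob) => v /other; by case.
have rev : revenue (ev n bid_cmd s3) = (revenue s2).+1.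
  rewrite /revenue (bigD1 b) //= pb addSn; congr _.+1.
  rewrite [RHS](bigD1 b) //=; congr (_ + _).
  by apply: eq_bigr => v /other[].
right; case: H2 => [[p2 o2 _]|[nf lt]]; last by split=> //; rewrite rev ltnW.
split; last by rewrite rev /revenue p2.
move=> /(_ i)[[v]|/(_ _ Eb)]; first by rewrite -o2 => /free.
by rewrite -p2 leqNgt ltb.
Qed.

Lemma auction_cmd_correct s : edges_loaded s ->
    (forall v, prices s v = 0) -> (forall v, owners s v = 0) ->
  let s' := ev n auction_cmd s in auction_state s' /\ finished s'.
Proof.
move=> L p0 o0; rewrite /auction_cmd ev_seq.
have A0 : auction_state s by split=> //; apply: auction_init.
set c := CLoop vj _; set s1 := ev n (CLoop vi c) s.
have inner i s2 : auction_state s2 -> finished s2 \/ i <= revenue s2 ->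
    auction_state (ev n c s2) /\
    (finished (ev n c s2) \/ i + n <= revenue (ev n c s2)).
  move=> A2 H2; apply: (loop_ind (I := fun j s' => auction_state s' /\
    (finished s' \/ i + j <= revenue s'))); first by rewrite addn0.
  by move=> j s3 [A3 H3]; rewrite addnS; apply: sweep_cmd_correct.
have [A1 H1] : auction_state s1 /\ (finished s1 \/ n * n <= revenue s1).
  apply: (loop_ind (I := fun i s' => auction_state s' /\
    (finished s' \/ i * n <= revenue s'))); first by split=> //; right.
  by move=> i s2 [A2 H2]; rewrite mulSnr; apply: inner.
have [A2 [H2|lt]] := sweep_cmd_correct A1 H1; split=> //.
move: lt; rewrite ltnNge => /negP[]; rewrite -{2}[n]card_ord -sum_nat_const.
by apply: leq_sum => v _; case: A2 => _ A2; apply: auction_le A2 _.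
Qed.

End AuctionProgram.

Section Candidates.
Variables (n : nat) (E : rel 'I_n) (bad : {set 'I_n}).

Definition bad_loaded (s : store) : Prop := forall v : 'I_n,
  (arr s aK v != 0) && ~~ (arr s aCol v != 0) = (v \in bad).

Lemma bad_loaded_frame c s : bad_loaded s ->
    aK \notin written_arrays c -> aCol \notin written_arrays c ->
  bad_loaded (ev n c s).
Proof. by move=> L w0 w1 v; rewrite !arr_frame. Qed.

Lemma cand_cmd_correct (s : store) : edges_loaded E s -> bad_loaded s ->
  let s' := ev n cand_cmd s in
  let S := (bad :|: price_cover E (prices s) (s.1 vk))%SET in
  (forall v : 'I_n, (arr s' aCand v != 0) = (v \in S)) /\ s'.1 vacc = #|S|.
Proof.
move=> L B s' S; rewrite {}/s' /cand_cmd ev_seq ev_set; set s1 := setv _ _ _.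
set c := CSeq _ _.
pose Cx s' := [/\ edges_loaded E s', bad_loaded s', prices (n := n) s' = prices s &
  s'.1 vk = s.1 vk].
suff [_ H ->] : let s' := ev n (CLoop vu c) s1 in
    [/\ Cx s', forall v : 'I_n, v < n -> (arr s' aCand v != 0) = (v \in S) &
      s'.1 vacc = \sum_(v < n | v < n) (v \in S)].
  split; first by move=> v; apply: H.
  rewrite -sum1_card [RHS]big_mkcond.
  by apply: eq_big => [w|w _]; rewrite ?ltn_ord //; case: (w \in S).
apply: (loop_ind (I := fun i s' => [/\ Cx s',
    forall v : 'I_n, v < i -> (arr s' aCand v != 0) = (v \in S) &
    s'.1 vacc = \sum_(v < n | v < i) (v \in S)])).
  by split=> //; rewrite big_pred0.
move=> i s2 [[L2 B2 p2 k2] H2 acc2].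
have Cx' c' s' : Cx s' -> all [pred a | a \notin written_arrays c']
    [:: aLive; aCol; aAdj; aRow; aK; aPrice] -> vk \notin written_vars c' ->
    Cx (ev n c' s').
  move=> [L' B' p' k'] /= /and5P[? ? ? ? /and3P[? ? _]] wk; split.
  - by apply: edges_loaded_frame => //; apply/and5P.
  - exact: bad_loaded_frame.
  - by rewrite prices_frame.
  - by rewrite var_frame.
have CxS : Cx (ev n c (setv s2 vu i)) by apply: Cx'.
rewrite /c !ev_seq (ev_set _ vflag) in CxS *; set s3 := setv _ vflag _ in CxS *.
set s4 := ev n (CWhen _ _) s3 in CxS *; set cw := CLoop vv _ in CxS *.
have C3 : Cx s3 by [].
have C4 : Cx s4 by apply: Cx'.
have f4 : (s4.1 vflag != 0) = ~~ ((i \in bad) || (s.1 vk < prices s i)).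
  rewrite /s4 ev_when holds_or holds_and holds_not holds_lt.
  rewrite -[holds n s3 (ERd aK _)]/(arr s2 aK i != 0).
  rewrite -[holds n s3 (ERd aCol _)]/(arr s2 aCol i != 0) B2.
  rewrite -[eval n s3 (EVar vk)]/(s2.1 vk) k2.
  rewrite -[eval n s3 (ERd _ _)]/(prices s2 i) p2.
  by case: (_ || _).
have [[C5 u5] f5] : (Cx (ev n cw s4) /\ (ev n cw s4).1 vu = i) /\
    ((ev n cw s4).1 vflag != 0) =
    (s4.1 vflag != 0) && [forall w, ~~ (E i w && (prices s w <= s.1 vk))].
  apply: (loop_all (I := fun s' => Cx s' /\ s'.1 vu = i)) => //.
    by split=> //; rewrite var_frame.
  move=> w s6 [C6 u6]; split; first by split; [exact: Cx' | rewrite var_frame].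
  have [L6 _ p6 k6] := C6; set s7 := setv _ _ _.
  rewrite ev_when holds_and (holds_edge (E := E) (u := i) (v := w)) //.
  rewrite holds_not holds_lt -leqNgt.
  rewrite -[eval n s7 (EVar vk)]/(s6.1 vk) k6.
  rewrite -[eval n s7 (ERd _ _)]/(prices s6 w) p6.
  by case: (_ && _); rewrite ?andbT ?andbF.
set s5 := ev n cw s4 in CxS C5 u5 f5 *.
have f5S : (s5.1 vflag != 0) = (i \notin S).
  rewrite f5 f4 !inE orbA [in RHS]negb_or negb_exists; congr (_ && _).
split=> //.
  move=> v; rewrite ltnS => le_v.
  rewrite -[arr _ aCand v]/(arr (ev n (CWr aCand (EVar vu) (ENot (EVar vflag))) s5) aCand v).
  rewrite arr_write // eqxx andTb -[eval n s5 (EVar vu)]/(s5.1 vu) u5.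
  have [->|ne] := eqVneq v i.
    by rewrite eqxx -/(holds n s5 _) holds_not -[holds n s5 _]/(s5.1 vflag != 0) f5S negbK.
  rewrite (_ : (v == i :> nat) = false); last exact: negbTE.
  rewrite /s5 arr_frame // /s4 arr_frame // arr_setv H2 // ltn_neqAle le_v andbT.
  exact: ne.
have acc5 : s5.1 vacc = s2.1 vacc by rewrite /s5 var_frame // /s4 var_frame.
transitivity (s5.1 vacc + (if s5.1 vflag != 0 then 0 else 1)); first by [].
rewrite acc5 acc2 f5S [RHS](bigD1 i) //= addnC; congr (_ + _).
  by case: (i \in S).
by apply: eq_bigl => w; rewrite -val_eqE /= ltnS; lia.
Qed.

Definition best (s : store) : {set 'I_n} := [set v : 'I_n | arr s aBest v != 0]%SET.

Lemma best_frame c s : aBest \notin written_arrays c -> best (ev n c s) = best s.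
Proof. by move=> w; apply/setP => v; rewrite !inE arr_frame. Qed.

Lemma keep_cmd_correct (s : store) (S : {set 'I_n}) :
    (forall v : 'I_n, (arr s aCand v != 0) = (v \in S)) ->
  let s' := ev n keep_cmd s in
  if s.1 vacc < s.1 vbest then s'.1 vbest = s.1 vacc /\ best s' = S
  else s' = s.
Proof.
move=> H s'; rewrite {}/s' /keep_cmd ev_when holds_lt.
rewrite -[eval n s (EVar vacc)]/(s.1 vacc) -[eval n s (EVar vbest)]/(s.1 vbest).
case: ltnP => // _; rewrite ev_seq ev_set; set s1 := setv _ _ _.
split; first by rewrite var_frame.
set c := CWr _ _ _.
suff [_ Hb] : let s' := ev n (CLoop vv c) s1 in
    (forall v : 'I_n, (arr s' aCand v != 0) = (v \in S)) /\
    (forall v : 'I_n, v < n -> (arr s' aBest v != 0) = (v \in S)).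
  by apply/setP => v; rewrite inE Hb.
apply: (loop_ind (I := fun i s' =>
    (forall v : 'I_n, (arr s' aCand v != 0) = (v \in S)) /\
    (forall v : 'I_n, v < i -> (arr s' aBest v != 0) = (v \in S)))) => //.
move=> i s2 [C2 B2]; split=> v; first by rewrite arr_frame // arr_setv C2.
rewrite ltnS => le_v; set s3 := setv _ _ _.
rewrite arr_write // eqxx andTb -[eval n s3 (EVar vv)]/(nat_of_ord i).
have [->|ne] := eqVneq v i; first by rewrite eqxx; exact: C2.
rewrite (_ : (v == i :> nat) = false); last exact: negbTE.
by rewrite arr_setv B2 // ltn_neqAle le_v andbT.
Qed.

Variable good : {set 'I_n} -> Prop.

Definition best_good (s : store) : Prop :=
  s.1 vbest <= n -> good (best s) /\ #|best s| = s.1 vbest.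

Lemma best_good_frame c s : best_good s ->
    aBest \notin written_arrays c -> vbest \notin written_vars c ->
  best_good (ev n c s).
Proof. by move=> B wa wv; rewrite /best_good best_frame // var_frame. Qed.

Lemma choose_cmd_correct s :
    0 < n -> (forall u v w, E u v -> ~~ E v w) ->
    (forall C, vertex_cover E C -> good (bad :|: C)%SET) ->
    auction_state E s -> finished E s -> bad_loaded s -> best_good s ->
  let s' := ev n choose_cmd s in
  [/\ best_good s', s'.1 vbest <= s.1 vbest &
    forall C, vertex_cover E C -> s'.1 vbest <= #|bad| + #|C|].
Proof.
move=> n0 bip valid [L A] fin B G0.
pose cand k := (bad :|: price_cover E (prices s) k)%SET.
have [|k s1 [L1 B1 p1 G1]|[_ _ _ G1] le1 min1] := loop_min (n := n) (x0 := vbest) (x := vk)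
  (c := CSeq cand_cmd keep_cmd) (s := s)
  (I := fun s' => [/\ edges_loaded E s', bad_loaded s',
          prices (n := n) s' = prices s & best_good s'])
  (F := fun k b => b = #|cand k|) isT.
- by [].
- set s2 := setv _ _ _.
  have [C3 acc3] := @cand_cmd_correct s2 L1 B1.
  have G3 : best_good (ev n cand_cmd s2) by apply: best_good_frame.
  have b3 : (ev n cand_cmd s2).1 vbest = s1.1 vbest by rewrite var_frame.
  have p2 : prices (n := n) s2 = prices s by [].
  rewrite p2 -/(cand (s2.1 vk)) -[s2.1 vk]/(nat_of_ord k) in C3 acc3.
  have := keep_cmd_correct C3; rewrite ev_seq acc3 b3.
  set s3 := ev n cand_cmd s2 in G3 b3 *.
  have L4 : edges_loaded E (ev n keep_cmd s3).
    by rewrite -ev_seq; apply: edges_loaded_frame.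
  have B4 : bad_loaded (ev n keep_cmd s3).
    by rewrite -ev_seq; apply: bad_loaded_frame.
  have p4 : prices (n := n) (ev n keep_cmd s3) = prices s.
    by rewrite -ev_seq prices_frame.
  case: ltnP => [lt [b4 S4]|le s4].
    split; rewrite ?b4; [split=> // | exact: ltnW | by move=> b ->].
    by move=> _; rewrite S4 b4; split=> //; apply/valid/price_cover_is_cover.
  by rewrite s4 in L4 B4 p4 *; rewrite b3; split=> [||b ->].
split=> // C cov.
have [k mink] := price_cover_min n0 bip A fin.
apply: leq_trans (min1 k _ erefl) _.
by apply: leq_trans (leq_of_leqif (leq_card_setU _ _)) _; rewrite leq_add2l mink.
Qed.

End Candidates.

Section Search.
Variables (R : realType) (n : nat) (G : sgraph 'I_n).

Notation good := (fun S => unit_interval_graph R (del_vertices G S)).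

Lemma shape_cmd_correct K x y z m s :
    graph_loaded G s -> clique_loaded K s -> split_partition G K ->
    shape_set x y z m s -> best_good good s ->
  let s' := ev n shape_cmd s in
  [/\ best_good good s', s'.1 vbest <= s.1 vbest &
    forall C, vertex_cover (live_edge G K x y z m) C ->
      s'.1 vbest <= #|inadmissible G K x y z m| + #|C|].
Proof.
move=> L LK sp Sh B.
rewrite -[ev n shape_cmd s]/(ev n choose_cmd (ev n auction_cmd (ev n setup_cmd s))).
set s1 := ev n setup_cmd s; set s2 := ev n auction_cmd s1.
have setup := setup_cmd_correct L LK Sh; rewrite -/s1 in setup.
have L1 : edges_loaded (live_edge G K x y z m) s1.
  move=> u v; have [_ -> _ _] := setup u; have [-> _ _ _] := setup v.
  have -> : arr s1 aAdj (arr s1 aRow u + v) = G u v by apply: graph_loaded_frame.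
  by rewrite eqb0 negbK.
have [A2 F2] : auction_state (live_edge G K x y z m) s2 /\
    finished (live_edge G K x y z m) s2.
  by apply: auction_cmd_correct => // v; have [] := setup v.
have bad1 : bad_loaded (inadmissible G K x y z m) s1.
  move=> v; have [-> _ _ _] := setup v.
  have -> : (arr s1 aK v != 0) = (v \in K) by apply: clique_loaded_frame.
  by rewrite inE; case: (v \in K).
have b2 : s2.1 vbest = s.1 vbest by rewrite !var_frame.
rewrite -b2; apply: choose_cmd_correct => //.
- by apply: leq_ltn_trans (ltn_ord x).
- by move=> u v w; apply: live_edge_bipartite.
- by move=> C; apply: deletion_sufficient.
- exact: bad_loaded_frame.
- by do 2!apply: best_good_frame => //.
Qed.

Lemma search_cmd_correct s : graph_loaded G s ->
  let s' := ev n search_cmd s in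
  best_good good s' /\
  forall (t x y z : 'I_n) m C, split_partition G (high_degree G t) ->
    vertex_cover (live_edge G (high_degree G t) x y z m) C ->
    s'.1 vbest <= #|inadmissible G (high_degree G t) x y z m| + #|C|.
Proof.
move=> L; rewrite /search_cmd ev_seq ev_set; set s1 := setv _ _ _.
have G1 : best_good good s1 by move=> H; exfalso; move: H; rewrite /s1 /= /upd /=; lia.
set cz := CSeq (CSeq _ _) _; set cx := CLoop vx _; set ct := CSeq _ _.
pose bound K x y z m b := exists2 C, vertex_cover (live_edge G K x y z m) C &
  b = #|inadmissible G K x y z m| + #|C|.
pose I (K : {set 'I_n}) s' := [/\ graph_loaded G s', clique_loaded K s' & best_good good s'].
have IF K c s' : I K s' -> all [pred a | a \notin written_arrays c]
    [:: aAdj; aRow; aK; aBest] -> vbest \notin written_vars c -> I K (ev n c s').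
  move=> [L' K' G'] /and5P[/= ? ? ? ? _] ?; split.
  - exact: graph_loaded_frame.
  - exact: clique_loaded_frame.
  - exact: best_good_frame.
have shape K x y z m s' : split_partition G K -> I K s' -> shape_set x y z m s' ->
    [/\ I K (ev n shape_cmd s'), (ev n shape_cmd s').1 vbest <= s'.1 vbest &
      forall b, bound K x y z m b -> (ev n shape_cmd s').1 vbest <= b].
  move=> sp [L' K' G'] Sh; have [G'' le H] := shape_cmd_correct L' K' sp Sh G'.
  split=> //; last by move=> b [C cov ->]; apply: H.
  by split=> //; [exact: graph_loaded_frame | exact: clique_loaded_frame].
have body K (x y z : 'I_n) s' : split_partition G K -> I K s' ->
    s'.1 vx = x -> s'.1 vy = y -> s'.1 vz = z ->
    [/\ I K (ev n cz s'), (ev n cz s').1 vbest <= s'.1 vbest &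
      forall b, (exists m, bound K x y z m b) -> (ev n cz s').1 vbest <= b].
  move=> sp I0 x0 y0 z0.
  rewrite -[ev n cz s']/(ev n shape_cmd (setv (ev n shape_cmd (setv s' vm 0)) vm 1)).
  have Sh2 : shape_set x y z false (setv s' vm 0) by split.
  have [I2 le2 H2] := shape K x y z false (setv s' vm 0) sp I0 Sh2.
  set s2 := ev n shape_cmd _ in I2 le2 H2 *.
  have Sh3 : shape_set x y z true (setv s2 vm 1).
    by split=> //; rewrite [LHS]/= /upd [LHS]/= /s2 var_frame.
  have [I3 le3 H3] := shape K x y z true (setv s2 vm 1) sp I2 Sh3.
  split=> //; first exact: leq_trans le3 le2.
  move=> b [[] Hb]; first exact: H3.
  by apply: leq_trans le3 _; apply: H2.
have loops K s' : split_partition G K -> I K s' ->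
    [/\ I K (ev n cx s'), (ev n cx s').1 vbest <= s'.1 vbest &
      forall x b, (exists y z m, bound K x y z m b) -> (ev n cx s').1 vbest <= b].
  move=> sp I0; apply: loop_min => // x s2 I2.
  have [] := @loop_min n vbest vy (CLoop vz cz) (setv s2 vx x)
    (fun s => I K s /\ s.1 vx = x)
    (fun y b => exists z m, bound K x y z m b) isT (conj I2 erefl).
    move=> y s3 [I3 x3].
    have [] := @loop_min n vbest vz cz (setv s3 vy y)
      (fun s => [/\ I K s, s.1 vx = x & s.1 vy = y])
      (fun z b => exists m, bound K x y z m b) isT.
    - by split.
    - move=> z s4 [I4 x4 y4].
      have [I5 le5 H5] := body K x y z (setv s4 vz z) sp I4 x4 y4 erefl.
      by split=> //; split=> //; rewrite var_frame.
    by move=> [I5 x5 y5] le5 H5; split=> // b [z Hz]; apply: H5 Hz.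
  by move=> [I3 x3] le3 H3; split=> // b [y Hy]; apply: H3 Hy.
have [|[_ G2] _ H2] := @loop_min n vbest vt ct s1
  (fun s => graph_loaded G s /\ best_good good s)
  (fun t b => split_partition G (high_degree G t) /\
     exists x y z m, bound (high_degree G t) x y z m b) isT (conj L G1); last first.
  split=> // t x y z m C sp cov; apply: (H2 t); split=> //.
  by exists x, y, z, m, C.
move=> t s2 [L2 B2]; rewrite /ct 2!ev_seq.
set s3 := ev n high_cmd _; set s4 := ev n check_cmd s3.
have L3 : graph_loaded G s3 by apply: graph_loaded_frame.
have K3 : clique_loaded (high_degree G t) s3 by apply: high_cmd_correct.
have f4 := check_cmd_correct L3 K3; rewrite -/s4 in f4.
have I4 : I (high_degree G t) s4.
  apply: (IF _ check_cmd) => //; split=> //.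
  exact: best_good_frame.
have b4 : s4.1 vbest = s2.1 vbest by rewrite /s4 var_frame // /s3 var_frame.
rewrite ev_when -[holds n s4 _]/(s4.1 vflag != 0) -b4.
case: ifPn => [/f4 sp|nsp].
  have [[L5 _ G5] le5 H5] := loops _ _ sp I4.
  by split=> // b [_ [x Hx]]; apply: H5 Hx.
by have [L5 _ G5] := I4; split=> // b [/f4 fl _]; rewrite fl in nsp.
Qed.

Lemma loop2_ind x y c s (J : nat -> store -> Prop) : J 0 s ->
    (forall k s' i, J k s' -> J k (setv s' x i)) ->
    (forall k s' i, k < n * n -> J k s' -> J k.+1 (ev n c (setv s' y i))) ->
  J (n * n) (ev n (CLoop x (CLoop y c)) s).
Proof.
move=> J0 JV JS; apply: (loop_ind (I := fun i => J (i * n))) => //.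
move=> i s1 J1; rewrite mulSnr.
apply: (loop_ind (I := fun j => J (i * n + j))); first by rewrite addn0; apply: JV.
move=> j s2 J2; rewrite addnS; apply: JS => //.
by have := ltn_ord i; have := ltn_ord j; nia.
Qed.

Lemma load_cmd_correct (s : store) : s.1 vacc = 0 ->
    (forall u v : 'I_n, s.2 (1 + u * n + v) = G u v) ->
  graph_loaded G (ev n load_cmd s).
Proof.
move=> acc0 mem0; rewrite /load_cmd 3!ev_seq.
set c3 := CLoop vi _; set c2 := CLoop vi _; set c1 := CLoop vi _.
set s1 := ev n c1 s; set s2 := ev n c2 s1; set s3 := ev n _ s2.
have [acc1 mem1] : s1.1 vacc = n * n /\ s1.2 = s.2.
  apply: (loop2_ind (J := fun k s' => s'.1 vacc = k /\ s'.2 = s.2)) => //.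
  move=> k s' i _ [acc' mem']; split=> //.
  by rewrite -[LHS]/(s'.1 vacc + 1) acc' addn1.
have [_ adj2 _] : [/\ s2.1 vacc = n * n - n * n,
    forall q, n * n - n * n < q <= n * n -> arr s2 aAdj q = s.2 q &
    forall q, q <= n * n - n * n -> s2.2 q = s.2 q].
  apply: (loop2_ind (J := fun k s' => [/\ s'.1 vacc = n * n - k,
    forall q, n * n - k < q <= n * n -> arr s' aAdj q = s.2 q &
    forall q, q <= n * n - k -> s'.2 q = s.2 q])) => //.
    by split=> [|q|q]; rewrite ?subn0 ?mem1 //; lia.
  move=> k s' i lt_k [acc' adj' mem'].
  set c := CWr _ _ _; set s4 := setv _ _ _.
  have acc4 : s4.1 vacc = n * n - k by [].
  rewrite ev_seq; split=> [|q Hq|q Hq].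
  - by rewrite -[LHS]/(s4.1 vacc - 1) acc4; lia.
  - rewrite -[LHS]/(arr (ev n c s4) aAdj q) arr_write // eqxx andTb.
    rewrite -[eval n s4 (EVar _)]/(s4.1 vacc).
    rewrite -[eval n s4 (ELoad _)]/(s4.2 (s4.1 vacc)) acc4.
    case: eqP => [->|ne]; first by apply: mem'.
    by apply: adj'; lia.
  - rewrite -[LHS]/(upd s4.2 (16 * s4.1 vacc + 0) (s4.2 (s4.1 vacc)) q) /upd acc4.
    by case: eqP => [|_]; [lia | apply: mem'; lia].
suff [_ row3] : (ev n c3 s3).1 vacc = 1 + n * n /\
    forall u : 'I_n, u < n -> arr (ev n c3 s3) aRow u = 1 + u * n.
  move=> u v; rewrite row3 // arr_frame // -[LHS]/(arr s2 aAdj (1 + u * n + v)).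
  rewrite adj2 //; have := ltn_ord u; have := ltn_ord v; nia.
apply: (loop_ind (I := fun i s' => s'.1 vacc = 1 + i * n /\
  forall u : 'I_n, u < i -> arr s' aRow u = 1 + u * n)) => //.
move=> i s4 [acc4 row4]; rewrite ev_seq; set c := CWr _ _ _; set s5 := ev n c _.
split.
  rewrite mulSnr addnA.
  apply: (loop_ind (I := fun j s' => s'.1 vacc = 1 + i * n + j)).
    by rewrite addn0 -acc4.
  by move=> j s' acc'; rewrite -[LHS]/(s'.1 vacc + 1) acc'; lia.
move=> u; rewrite ltnS => le_u; rewrite arr_frame // /s5 /c.
rewrite arr_write // eqxx andTb.
set s6 := setv _ _ _; rewrite -[eval n s6 (EVar vi)]/(nat_of_ord i).
rewrite -[eval n s6 (EVar vacc)]/(s4.1 vacc) acc4.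
have [->|ne] := eqVneq u i; first by rewrite eqxx.
rewrite (_ : (u == i :> nat) = false); last exact: negbTE.
by rewrite arr_setv row4 // ltn_neqAle le_u andbT.
Qed.

(* The output overlaps the arrays, but cell [v] is overwritten only after the *)
(* cells [16 w + 8] with [w <= v] have been read.                             *)
Lemma output_cmd_correct (s : store) (v : 'I_n) :
  (ev n output_cmd s).2 v = arr s aBest v.
Proof.
suff [] : (forall u : 'I_n, u < n -> (ev n output_cmd s).2 u = arr s aBest u) /\
  (forall u : 'I_n, n <= u -> arr (ev n output_cmd s) aBest u = arr s aBest u).
  by move=> H _; apply: H.
apply: (loop_ind (I := fun i s' =>
  (forall u : 'I_n, u < i -> s'.2 u = arr s aBest u) /\
  (forall u : 'I_n, i <= u -> arr s' aBest u = arr s aBest u))) => //.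
move=> i s1 [out1 best1]; set s2 := setv _ _ _.
have E w : (ev n (CStore (EVar vv) (ERd aBest (EVar vv))) s2).2 w =
    if w == i then arr s1 aBest i else s1.2 w by [].
split=> u ui; last first.
  by rewrite /arr E; case: eqP => [|_]; [lia | apply: best1; lia].
rewrite E; case: eqP => [->|ne]; first exact: best1.
by apply: out1; lia.
Qed.

Lemma nth_allpairs (A B C : Type) (f : A -> B -> C) x0 y0 z0 s t i j :
    i < size s -> j < size t ->
  nth z0 [seq f x y | x <- s, y <- t] (i * size t + j) =
  f (nth x0 s i) (nth y0 t j).
Proof.
elim: s i => [//|x s IH] [|i] /= lt_i lt_j; rewrite nth_cat size_map.
  by rewrite add0n lt_j (nth_map y0).
rewrite mulSn -addnA ltnNge leq_addr /= addKn; exact: IH.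
Qed.

Lemma nth_encode (u v : 'I_n) : nth 0 (encode G) (1 + u * n + v) = G u v.
Proof.
have := @nth_allpairs _ _ _ (fun u v => nat_of_bool (G u v)) u v 0
  (enum 'I_n) (enum 'I_n) u v.
by rewrite size_enum_ord !nth_ord_enum -addnA add1n => H; apply: H.
Qed.

End Search.

Lemma halted_end i c r m : halted (i :: c) (State (1 + size c) r m).
Proof. exact: leqnn. Qed.

Theorem theorem3 (R : realType) :
  solvable_in_polytime
    (fun n (G : sgraph 'I_n) => split_graph G)
    (fun n (G : sgraph 'I_n) (S : {set 'I_n}) =>
       min_deletion_set (@unit_interval_graph R) G S).
Proof.
exists main_program, (1%N%:P + pcost main_cmd)%R => n G split_G.
pose s0 : store := (fun=> 0, nth 0 (encode G)).
pose s1 := ev n load_cmd s0; pose s2 := ev n search_cmd s1.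
pose s3 := ev n main_cmd s0.
have [r [[t t_le run_t] _ _]] : exists r', [/\
    steps main_program (cost n main_cmd) (State 1 (upd (fun=> 0) 0 n) s0.2)
      (State (1 + size (ccmd 1 1 main_cmd)) r' s3.2),
    vars_in n s3.1 r' & keeps_temp 1 (upd (fun=> 0) 0 n) r'].
  apply: ccmd_correct => //.
  by exists [:: ILoad 0 1], [::]; rewrite cats0.
have run1 : run main_program (t + 1) (init_state G) =
    State (1 + size (ccmd 1 1 main_cmd)) r s3.2.
  by rewrite -run_t /run iterD.
exists (t + 1); rewrite run1; split; last first.
- have out : output_set n (State (1 + size (ccmd 1 1 main_cmd)) r s3.2) = best n s2.
    by apply/setP => v; rewrite !inE -(output_cmd_correct s2).
  rewrite out.
  have L1 : graph_loaded G s1.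
    by apply: load_cmd_correct => // u v; apply: nth_encode.
  have [good2 min2] := search_cmd_correct R L1; rewrite -/s2 in good2 min2.
  have [n0|n_gt0] := posnP n.
    split; last first.
      move=> S' _; apply: leq_trans (max_card _) _.
      by rewrite card_ord {1}n0.
    apply/unit_interval_inducedP; exists 1%R, (fun=> 0%R).
    by split; rewrite ?ltr01 // => u; exfalso; have := ltn_ord u; rewrite {2}n0.
  have [t0 lt_t0 sp] := split_partition_high_degree split_G
    (eq_ind_r (fun k => 0 < k) n_gt0 (card_ord n)).
  rewrite card_ord in lt_t0.
  have opt S' : unit_interval_graph R (del_vertices G S') -> s2.1 vbest <= #|S'|.
    move=> /(deletion_necessary n_gt0 sp)[x [y [z [m [sub cov]]]]].
    apply: leq_trans (min2 (Ordinal lt_t0) _ _ _ _ _ sp cov) _.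
    by rewrite -(cardsID (inadmissible G (high_degree G t0) x y z m) S')
      (finset.setIidPr sub).
  have le_n : s2.1 vbest <= n.
    rewrite -[leqRHS]card_ord -cardsT; apply: opt.
    apply/unit_interval_inducedP; exists 1%R, (fun=> 0%R).
    by split; rewrite ?ltr01 // => u v; rewrite !inE.
  have [good_best card_best] := good2 le_n.
  by split=> // S' /opt; rewrite card_best.
- exact: halted_end.
- by rewrite hornerD hornerC horner_pcost addnC leq_add2l.
Qed.
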